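(* Let $(G,X)$ be a Shimura datum and $K\subset G(\mathbb A_f)$ a neat compact open subgroup. Let $L$ be a number field containing $E(G,X)$, let $x=[s,\overline 1]$ be a point of $\mathrm{Sh}_K(G,X)(L)$ and let $\rho_{\widetilde x}$ be the Galois representation attached to $\widetilde x=[s,1]$. Let $M$ be the Mumford–Tate group of $s$ and let $L'$ be the subfield of $\overline{\mathbb Q}$ generated by $L$ and the reflex field $E(M,X_M)$. Then $$\rho_{\widetilde x}(\mathrm{Gal}(\overline L/L'))\subset M(\mathbb A_f)\cap K,$$ and, for every prime $l$, $$\rho_{\widetilde x,l}(\mathrm{Gal}(\overline L/L'))\subset M(\mathbb Q_l)\cap K_l .$$
   Context: Conventions. $\mathbb S=\mathrm{Res}_{\mathbb C/\mathbb R}\mathbb G_{m,\mathbb C}$. Number fields are subfields of $\mathbb C$; reductive groups are connected; $\mathbb A_f$ is the ring of finite adeles of $\mathbb Q$. A Shimura datum $(G,X)$ is a reductive $\mathbb Q$-group $G$ with a $G(\mathbb R)$-conjugacy class $X$ of morphisms $\mathbb S\to G_{\mathbb R}$ such that for $s\in X$: the Hodge structure on $\mathrm{Lie}(G_{\mathbb R})$ given by $\mathrm{Ad}\circ s$ is of type $\{(-1,1),(0,0),(1,-1)\}$; $\mathrm{ad}\,s(i)$ is a Cartan involution of $G^{\mathrm{ad}}_{\mathbb R}$; $G^{\mathrm{ad}}$ has no $\mathbb Q$-factor on which the projection of $s$ is trivial. $MT(s)$ (the Mumford–Tate group of $s$) is the smallest $\mathbb Q$-subgroup $M$ of $G$ such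 that $s$ factors through $M_{\mathbb R}$; $MT(X)$ is the smallest $\mathbb Q$-subgroup containing all $MT(s)$, $s\in X$; it is always assumed that $G=MT(X)$. $E(G,X)$ is the reflex field. For $K\subset G(\mathbb A_f)$ compact open, $\mathrm{Sh}_K(G,X)$ is the canonical model over $E(G,X)$, with $\mathrm{Sh}_K(G,X)(\mathbb C)=G(\mathbb Q)\backslash X\times G(\mathbb A_f)/K$, and $\mathrm{Sh}(G,X)=\varprojlim_K\mathrm{Sh}_K(G,X)$, with $\mathrm{Sh}(G,X)(\mathbb C)=G(\mathbb Q)\backslash X\times G(\mathbb A_f)$. $[s,\overline g]$ and $[s,g]$ denote the images of $(s,g)\in X\times G(\mathbb A_f)$ in these two sets. An element $g=(g_p)\in G(\mathbb A_f)$ is neat if, for a faithful representation of $G$ and $\Gamma_p\subset\overline{\mathbb Q}_p^*$ the group generated by the eigenvalues of $g_p$, one has $\bigcap_p(\overline{\mathbb Q}^*\cap\Gamma_p)_{\mathrm{tors}}=\{1\}$; a subgroup is neat if all its elements are. $X_M$ is the $M(\mathbb R)$-conjugacy class of $s$; $(M,X_M)$ is a Shimura datum with reflex field $E(M,X_M)$. Galois representations. Let $\pi:\mathrm{Sh}(G,X)\to\mathrm{Sh}_K(G,X)$ be the projection ($K$ neat). The right action of $K$ on $\pi^{-1}(x)$ is simply transitive and commutes with the left action of $\mathrm{Gal}(\overline L/L)$; $\rho_{\widetilde x}:\mathrm{Gal}(\overline L/L)\to K$ is the homomorphism with $\sigma(\widetilde x)=[s,\rho_{\widetilde x}(\sigma)]$.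 For a prime $l$, let $p_l:G(\mathbb A_f)\to G(\mathbb Q_l)$ be the projection; $K_l=p_l(K)$ and $\rho_{\widetilde x,l}=p_l\circ\rho_{\widetilde x}$. *)

(* Defs.v *)
From HB Require Import structures.
From mathcomp Require Import all_boot all_order all_algebra.
From mathcomp Require Import complex.
From mathcomp Require Import all_classical all_reals all_analysis.
From mathcomp Require Import -(notations) mpoly.
Set Implicit Arguments.
Unset Strict Implicit.
Unset Printing Implicit Defensive.
Import Order.TTheory GRing.Theory Num.Theory.
Import numFieldNormedType.Exports.
Local Open Scope classical_set_scope.
Local Open Scope ring_scope.

Definition prime_t := {p : nat | prime p}.
Definition pnat (p : prime_t) : nat := val p.

Section Zp.
Variable p : prime_t.
Let q (k : nat) : int := (pnat p ^ k)%N%:Z.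

Definition coherent : pred (nat -> int) := fun x =>
  `[< forall k, x k = (x k %% q k)%Z /\ (x k.+1 %% q k)%Z = x k >].

Record Zp := MkZp { zpval :> nat -> int; _ : coherent zpval }.
HB.instance Definition _ := [isSub for zpval].
HB.instance Definition _ := [Choice of Zp by <:].

Lemma coherentP (x : Zp) k : (x k %% q k)%Z = x k.
Proof. by case: x => x /= /asboolP h; case: (h k) => <-. Qed.
Lemma coherentS (x : Zp) k : (x k.+1 %% q k)%Z = x k.
Proof. by case: x => x /= /asboolP h; case: (h k). Qed.

Lemma modq (a : int) k : ((a %% q k.+1)%Z %% q k)%Z = (a %% q k)%Z.
Proof.
have -> : q k.+1 = q k * (pnat p)%:Z by rewrite /q expnSr PoszM.
rewrite [in RHS](divz_eq a (q k * (pnat p)%:Z)) mulrA mulrAC.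
by rewrite modzMDl.
Qed.

Lemma mk_coherent (f : nat -> int) :
  (forall k, (f k.+1 %% q k)%Z = (f k %% q k)%Z) ->
  coherent (fun k => f k %% q k)%Z.
Proof. by move=> H; apply/asboolP => k; rewrite modz_mod modq H. Qed.

Definition mkzp f H : Zp := MkZp (@mk_coherent f H).

Lemma zp_eq (x y : Zp) : (forall k, x k = y k) -> x = y.
Proof. by move=> H; apply/val_inj/funext. Qed.

Lemma zp_addP (x y : Zp) k : ((x k.+1 + y k.+1) %% q k)%Z = ((x k + y k) %% q k)%Z.
Proof. by rewrite -modzDm !coherentS. Qed.
Lemma zp_mulP (x y : Zp) k : ((x k.+1 * y k.+1) %% q k)%Z = ((x k * y k) %% q k)%Z.
Proof. by rewrite -modzMm !coherentS. Qed.
Lemma zp_oppP (x : Zp) k : ((- x k.+1) %% q k)%Z = ((- x k) %% q k)%Z.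
Proof. by rewrite -modzNm coherentS. Qed.

Definition zp_add x y := mkzp (zp_addP x y).
Definition zp_mul x y := mkzp (zp_mulP x y).
Definition zp_opp x := mkzp (zp_oppP x).
Definition zp_cst (a : int) : Zp := @mkzp (fun=> a) (fun=> erefl).

Lemma zp_addA : associative zp_add.
Proof. by move=> x y z; apply: zp_eq => k /=; rewrite modzDml modzDmr addrA. Qed.
Lemma zp_addC : commutative zp_add.
Proof. by move=> x y; apply: zp_eq => k /=; rewrite addrC. Qed.
Lemma zp_add0 : left_id (zp_cst 0) zp_add.
Proof. by move=> x; apply: zp_eq => k /=; rewrite modzDml add0r coherentP. Qed.
Lemma zp_addN : left_inverse (zp_cst 0) zp_opp zp_add.
Proof. by move=> x; apply: zp_eq => k /=; rewrite modzDml addNr. Qed.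
HB.instance Definition _ := GRing.isZmodule.Build Zp zp_addA zp_addC zp_add0 zp_addN.

Lemma zp_mulA : associative zp_mul.
Proof. by move=> x y z; apply: zp_eq => k /=; rewrite modzMml modzMmr mulrA. Qed.
Lemma zp_mulC : commutative zp_mul.
Proof. by move=> x y; apply: zp_eq => k /=; rewrite mulrC. Qed.
Lemma zp_mul1 : left_id (zp_cst 1) zp_mul.
Proof. by move=> x; apply: zp_eq => k /=; rewrite modzMml mul1r coherentP. Qed.
Lemma zp_mulD : left_distributive zp_mul zp_add.
Proof. by move=> x y z; apply: zp_eq => k /=; rewrite modzMml modzDm mulrDl. Qed.
Lemma zp_1neq0 : zp_cst 1 != 0.
Proof.
apply/eqP => /(congr1 (fun x : Zp => x 1%N)) /=; rewrite /q expn1.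
have p1 := prime_gt1 (valP p); rewrite mod0z modz_small //=.
Qed.
HB.instance Definition _ :=
  GRing.Zmodule_isComNzRing.Build Zp zp_mulA zp_mulC zp_mul1 zp_mulD zp_1neq0.

Definition zp_unit : pred Zp := fun x => `[< exists y : Zp, y * x = 1 >].
Definition zp_inv (x : Zp) : Zp :=
  if pselect (exists y : Zp, y * x = 1) is left h then projT1 (cid h) else x.
Lemma zp_mulVx : {in zp_unit, left_inverse 1 zp_inv *%R}.
Proof.
move=> x /asboolP h; rewrite /zp_inv; case: pselect => [h'|//].
exact: projT2 (cid h').
Qed.
Lemma zp_unitP (x y : Zp) : y * x = 1 -> zp_unit x.
Proof. by move=> h; apply/asboolP; exists y. Qed.
Lemma zp_inv_out : {in [predC zp_unit], zp_inv =1 id}.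
Proof.
move=> x /negP h; rewrite /zp_inv; case: pselect => // h'.
by case: h; apply/asboolP.
Qed.
HB.instance Definition _ :=
  GRing.ComNzRing_hasMulInverse.Build Zp zp_mulVx zp_unitP zp_inv_out.

Lemma zp_coh (x : Zp) i j : (x (i + j)%N %% q i)%Z = x i.
Proof.
elim: j => [|j IH]; first by rewrite addn0 coherentP.
rewrite addnS -IH -(coherentS x (i + j)).
have -> : q (i + j) = q j * q i by rewrite /q -PoszM -expnD addnC.
by rewrite [in LHS](divz_eq (x (i + j).+1) (q j * q i)) mulrA modzMDl.
Qed.

Lemma zp_idom : GRing.integral_domain_axiom Zp.
Proof.
move=> x y xy0; apply/norP => -[x0 y0].
have nz (z : Zp) : z != 0 -> exists i, ~~ (q i %| z i)%Z.
  move=> /eqP z0; apply: contrapT => H; apply: z0; apply: zp_eq => k /=.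
  rewrite mod0z -coherentP; apply/dvdz_mod0P.
  by apply: contrapT => /negP Hk; apply: H; exists k.
have [i xi] := nz _ x0; have [j yj] := nz _ y0.
have dx : ~~ (q i %| x (i + j)%N)%Z.
  by apply: contra xi => /dvdz_mod0P; rewrite zp_coh => ->; exact: dvdz0.
have dy : ~~ (q j %| y (i + j)%N)%Z.
  apply: contra yj => /dvdz_mod0P; rewrite addnC zp_coh => ->; exact: dvdz0.
have := congr1 (fun z : Zp => z (i + j)%N) xy0; rewrite /= mod0z => /dvdz_mod0P.
move: dx dy; rewrite /q !dvdzE abszM !absz_nat.
move: `|x (i + j)%N|%N `|y (i + j)%N|%N => a b da db dab.
have a0 : (0 < a)%N by case: a da {dab} => //; rewrite dvdn0.
have b0 : (0 < b)%N by case: b db {dab} => //; rewrite dvdn0.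
have pp : prime (pnat p) := valP p.
move: da db dab; rewrite !pfactor_dvdn ?muln_gt0 ?a0 //.
rewrite lognM // -!ltnNge => da db.
by rewrite leqNgt -addSn leq_add // ltnW.
Qed.
HB.instance Definition _ := GRing.ComUnitRing_isIntegral.Build Zp zp_idom.
End Zp.

Notation Qp p := {fraction (Zp p)}.

Definition is_subgroup (F : fieldType) n (A : set 'M[F]_n) :=
  [/\ A `<=` [set g | g \in unitmx], A 1%:M,
      forall g h, A g -> A h -> A (g *m h) & forall g, A g -> A (invmx g)].

(* Polynomials in the n * n matrix entries; mxvec fixes the order of the
   entries.  ratr is the embedding of Q when F has characteristic 0. *)
Definition qpoly n := mpoly.mpoly (n * n) rat.

Definition qeval (F : fieldType) n (f : qpoly n) (g : 'M[F]_n) : F :=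
  mpoly.mmap ratr (fun i => mxvec g 0 i) f.

Definition qzeros (F : fieldType) n (I : set (qpoly n)) : set 'M[F]_n :=
  [set g | g \in unitmx /\ forall f, I f -> qeval f g = 0].
Arguments qzeros F {n} I.

(* A linear algebraic group over Q, as a closed subgroup of GL_n.  In
   characteristic 0 it is reduced, so that it is determined by its points. *)
Record qgroup n := QGroup {
  qeqs : set (qpoly n);
  qgroupP : forall F : fieldType, [pchar F] =i pred0 ->
    is_subgroup (qzeros F qeqs) }.

Definition qpts n (G : qgroup n) (F : fieldType) : set 'M[F]_n :=
  qzeros F (qeqs G).
Arguments qpts {n} G F.

Definition qsub n (H G : qgroup n) :=
  forall F : fieldType, [pchar F] =i pred0 -> qpts H F `<=` qpts G F.

(* A morphism from a subgroup of GL_m to GL_n over Q: polynomials in the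
   entries and the inverse of the determinant. *)
Record qmap m n := QMap { qmap_num : 'I_n -> 'I_n -> qpoly m; qmap_den : nat }.

Definition qapp m n (phi : qmap m n) (F : fieldType) (g : 'M[F]_m) : 'M[F]_n :=
  \matrix_(i, j) (qeval (qmap_num phi i j) g / \det g ^+ qmap_den phi).

Definition qhom m n (H : qgroup m) (G : qgroup n) (phi : qmap m n) :=
  forall F : fieldType, [pchar F] =i pred0 ->
    (forall g, qpts H F g -> qpts G F (qapp phi g)) /\
    (forall g h, qpts H F g -> qpts H F h ->
      qapp phi (g *m h) = qapp phi g *m qapp phi h).

Section Adeles.

Definition zint (p : prime_t) : set (Qp p) := [set x | exists z : Zp p, x = tofrac z].

(* An element of GL_n(A_f) is the family of its components. *)
Definition adele n := forall p : prime_t, 'M[Qp p]_n.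
Definition amul n (g h : adele n) : adele n := fun p => g p *m h p.
Definition aone n : adele n := fun p => 1%:M.
Definition ainv n (g : adele n) : adele n := fun p => invmx (g p).
Definition arat n (g : 'M[rat]_n) : adele n := fun p => map_mx ratr g.

Definition apts n (G : qgroup n) : set (adele n) :=
  [set g | (forall p, qpts G (Qp p) (g p)) /\
           exists B : nat, forall p, (B < pnat p)%N ->
             forall i j, zint (g p i j) /\ zint (invmx (g p) i j)].

Definition acongr n (N : nat) : set (adele n) :=
  [set g | forall p i j,
     (exists2 z, zint z & (g p - 1%:M) i j = N%:R * z) /\
     (exists2 z, zint z & (invmx (g p) - 1%:M) i j = N%:R * z)].

(* The topology of the restricted product: the principal congruence subgroups
   are a basis of neighbourhoods of 1. *)
Definition aopen n (G : qgroup n) (U : set (adele n)) :=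
  U `<=` apts G /\
  forall g, U g -> exists2 N : nat, (0 < N)%N &
    forall h, apts G h -> acongr N h -> U (amul g h).

Definition acompact n (G : qgroup n) (K : set (adele n)) :=
  forall W : set (set (adele n)), (forall U, W U -> aopen G U) ->
    K `<=` \bigcup_(U in W) U ->
    exists W', [/\ W' `<=` W, finite_set W' & K `<=` \bigcup_(U in W') U].

Definition compact_open_subgroup n (G : qgroup n) (K : set (adele n)) :=
  [/\ aopen G K, acompact G K, K (aone n),
      forall g h, K g -> K h -> K (amul g h) & forall g, K g -> K (ainv g)].

Definition aapp m n (phi : qmap m n) (g : adele m) : adele n :=
  fun p => qapp phi (g p).
End Adeles.

Section Qbar.
Variable R : realType.

Definition algebraic_number : pred R[i] :=
  fun z => `[< algebraicOver (@ratr R[i]) z >].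

Lemma algebraic_number_divring : divring_closed algebraic_number.
Proof.
split=> [|x y|x y].
- by apply/asboolP; rewrite -(rmorph1 (@ratr R[i])); exact: algebraic_id.
- by move=> /asboolP hx /asboolP hy; apply/asboolP; exact: algebraic_sub.
- by move=> /asboolP hx /asboolP hy; apply/asboolP; exact: algebraic_div.
Qed.
HB.instance Definition _ :=
  GRing.isDivringClosed.Build R[i] algebraic_number algebraic_number_divring.

Record Qbar := MkQbar { qbval :> R[i]; _ : algebraic_number qbval }.
HB.instance Definition _ := [isSub for qbval].
HB.instance Definition _ := [Choice of Qbar by <:].
HB.instance Definition _ := [SubChoice_isSubComUnitRing of Qbar by <:].
HB.instance Definition _ := [SubComUnitRing_isSubIntegralDomain of Qbar by <:].
HB.instance Definition _ := [SubIntegralDomain_isSubField of Qbar by <:].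

Definition is_subfield (E : set R[i]) :=
  [/\ E 1, forall x y, E x -> E y -> E (x - y) &
      forall x y, E x -> E y -> E (x / y)].

Definition number_field (L : set R[i]) :=
  is_subfield L /\
  exists (d : nat) (b : 'I_d -> R[i]), forall x, L x ->
    exists c : 'I_d -> rat, x = \sum_(i < d) ratr (c i) * b i.

Definition compositum (E F : set R[i]) : set R[i] :=
  [set x | forall A, is_subfield A -> E `<=` A -> F `<=` A -> A x].

(* Gal(Qbar / L), for a subfield L of Qbar. *)
Definition Gal (L : set R[i]) : set {rmorphism Qbar -> Qbar} :=
  [set sigma : {rmorphism Qbar -> Qbar} | bijective sigma /\
     forall x : Qbar, L (qbval x) -> sigma x = x].

(* An algebraic closure of Q_p, with an embedding of Qbar. *)
Record padic_closure (p : prime_t) := PadicClosure {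
  pc_field : closedFieldType;
  pc_in : {rmorphism Qp p -> pc_field};
  pc_qbar : {rmorphism Qbar -> pc_field};
  pc_algebraic : forall x : pc_field, algebraicOver pc_in x }.

Definition pc_int p (cl : padic_closure p) : set (pc_field cl) :=
  [set x | exists2 P : {poly Zp p}, P \is monic &
     root (map_poly (fun z => pc_in cl (tofrac z)) P) x].

Definition pc_max p (cl : padic_closure p) : set (pc_field cl) :=
  [set x | exists2 k : nat, (0 < k)%N &
     exists2 y, pc_int y & x ^+ k = (pnat p)%:R * y].

Variable cl : forall p, padic_closure p.

(* The subgroup Gamma_p generated by the eigenvalues of g_p. *)
Definition eigen_group n (g : adele n) p : set (pc_field (cl p)) :=
  [set x | forall A : set (pc_field (cl p)),
     (forall l, root (char_poly (map_mx (pc_in (cl p)) (g p))) l -> A l) ->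
     A 1 -> (forall a b, A a -> A b -> A (a / b)) -> A x].

Definition neat_elt n (g : adele n) :=
  forall z : Qbar, (exists2 k : nat, (0 < k)%N & z ^+ k = 1) ->
    (forall p, @eigen_group n g p (pc_qbar (cl p) z)) -> z = 1.

Definition neat_level n (G : qgroup n) (K : set (adele n)) :=
  compact_open_subgroup G K /\ forall k, K k -> neat_elt k.

(* tau determines the place x |-> |tau x|_p of Qbar above p. *)
Definition frobenius p (tau : {rmorphism Qbar -> Qbar}) (q : nat)
    (sigma : {rmorphism Qbar -> Qbar}) :=
  forall x, pc_int (pc_qbar (cl p) (tau x)) ->
    pc_max (pc_qbar (cl p) (tau (sigma x)) - pc_qbar (cl p) (tau x) ^+ q).

Definition same_place p (E : set R[i]) (tau tau' : {rmorphism Qbar -> Qbar}) :=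
  forall x : Qbar, E (qbval x) ->
    (pc_int (pc_qbar (cl p) (tau x)) <-> pc_int (pc_qbar (cl p) (tau' x))).

End Qbar.

Section ShimuraData.
Variable R : realType.
Local Notation C := R[i].

Definition ceval m (f : mpoly.mpoly m C) (x : 'rV[C]_m) : C :=
  mpoly.mmap idfun (fun i => x 0 i) f.

Definition zclosed n (A : set 'M[C]_n) :=
  exists I : set (mpoly.mpoly (n * n) C),
    A = [set g | g \in unitmx /\ forall f, I f -> ceval f (mxvec g) = 0].

Definition zconnected n (A : set 'M[C]_n) :=
  forall Z1 Z2, zclosed Z1 -> zclosed Z2 -> A `<=` Z1 `|` Z2 ->
    A `&` Z1 `&` Z2 = set0 -> A `<=` Z1 \/ A `<=` Z2.

Definition normalizes n (A U : set 'M[C]_n) :=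
  forall g u, A g -> U u -> U (g *m u *m invmx g).

(* Connected, with trivial (geometric) unipotent radical. *)
Definition reductive n (G : qgroup n) :=
  zconnected (qpts G C) /\
  forall U : set 'M[C]_n, zclosed U -> is_subgroup U -> zconnected U ->
    U `<=` qpts G C -> normalizes (qpts G C) U ->
    (forall u, U u -> char_poly u = ('X - 1%:P) ^+ n) ->
    forall u, U u -> u = 1%:M.

Definition is_torus n (T : qgroup n) :=
  zconnected (qpts T C) /\
  exists2 P : 'M[C]_n, P \in unitmx &
    forall t, qpts T C t -> is_diag_mx (P *m t *m invmx P).

(* A morphism S -> GL_n over R is determined by its values on S(R) = C^*; the
   value at 0 is irrelevant and set to 0. *)
Definition dhom n := C -> 'M[R]_n.

Definition is_dhom n (G : qgroup n) (s : dhom n) :=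
  [/\ s 0 = 0,
      forall z, z != 0 -> qpts G R (s z),
      forall z w, z != 0 -> w != 0 -> s (z * w) = s z *m s w &
      exists (k : nat) (P : 'I_n -> 'I_n -> mpoly.mpoly 2 R),
        forall z i j, z != 0 ->
          s z i j = mpoly.mmap idfun
                      (fun l : 'I_2 => if l == 0 then complex.Re z else complex.Im z)
                      (P i j)
                    / (complex.Re z ^+ 2 + complex.Im z ^+ 2) ^+ k].

Definition conj_dhom n (g : 'M[R]_n) (s : dhom n) : dhom n :=
  fun z => g *m s z *m invmx g.

Definition conj_class n (G : qgroup n) (s : dhom n) : set (dhom n) :=
  [set t | exists2 g, qpts G R g & t = conj_dhom g s].

Definition app_dhom m n (phi : qmap m n) (s : dhom m) : dhom n :=
  fun z => if z == 0 then 0 else qapp phi (s z).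

Definition toC n (g : 'M[R]_n) : 'M[C]_n := map_mx (real_complex R) g.
Definition conjmx n (g : 'M[C]_n) : 'M[C]_n := map_mx (@conjc R) g.
Definition Ad n (g v : 'M[C]_n) : 'M[C]_n := g *m v *m invmx g.

(* The tangent space at 1, inside M_n(C). *)
Definition lieC n (G : qgroup n) : set 'M[C]_n :=
  [set v | forall f : qpoly n, (forall g, qpts G C g -> qeval f g = 0) ->
     \sum_i mxvec v 0 i * qeval (mpoly.mderiv i f) (1%:M : 'M[C]_n) = 0].

(* The part of type (k, -k) of Lie(G); s(z) acts on the part of type (p, q)
   of a Hodge structure as the scalar z^-p * conj(z)^-q. *)
Definition hodge_piece n (G : qgroup n) (s : dhom n) (k : int) : set 'M[C]_n :=
  [set v | lieC G v /\ forall z : C, z != 0 ->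
     Ad (toC (s z)) v = (conjc z / z) ^ k *: v].

Definition hodge_type n (G : qgroup n) (s : dhom n) :=
  forall v, lieC G v -> exists v1 v2 v3,
    [/\ hodge_piece G s (-1) v1, hodge_piece G s 0 v2, hodge_piece G s 1 v3 &
        v = v1 + v2 + v3].

(* G^ad is the image of the adjoint representation.  twisted_real is the
   inverse image in G(C) of the real form {x in G^ad(C) | x = theta(conj x)}
   of G^ad, for theta = ad(s(i)), and theta is a Cartan involution when this
   real form is compact.  The rows of P are (a basis of) Lie(G), and
   P *m lin_mx (Ad g) is the restriction of Ad(g) to it. *)
Definition twisted_real n (G : qgroup n) (s : dhom n) : set 'M[C]_n :=
  [set g | qpts G C g /\ forall v, lieC G v ->
     Ad (toC (s 'i%C)) (Ad (conjmx g) (Ad (invmx (toC (s 'i%C))) v)) = Ad g v].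

Definition cartan n (G : qgroup n) (s : dhom n) :=
  forall P : 'M[C]_(n * n),
    (forall v : 'M[C]_n, (mxvec v <= P)%MS <-> lieC G v) ->
    compact [set A : 'M[R]_(n * n) * 'M[R]_(n * n) |
      exists2 g, twisted_real G s g &
        A = (map_mx (@complex.Re R) (P *m lin_mx (Ad g)),
             map_mx (@complex.Im R) (P *m lin_mx (Ad g)))].

(* G^ad is semisimple of adjoint type: its factors are its quotients, that is
   the G / N for N normal in G containing the centre of G. *)
Definition no_trivial_factor n (G : qgroup n) (s : dhom n) :=
  forall N : qgroup n, qsub N G -> normalizes (qpts G C) (qpts N C) ->
    (forall z, qpts G C z -> (forall g, qpts G C g -> z *m g = g *m z) ->
       qpts N C z) ->
    (forall z, z != 0 -> qpts N R (s z)) -> qsub G N.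

Definition mumford_tate n (G : qgroup n) (s : dhom n) (M : qgroup n) :=
  [/\ qsub M G, forall z, z != 0 -> qpts M R (s z) &
      forall H, qsub H G -> (forall z, z != 0 -> qpts H R (s z)) -> qsub M H].

(* G = MT(X). *)
Definition mt_generated n (G : qgroup n) (X : set (dhom n)) :=
  forall H, qsub H G ->
    (forall s M, X s -> mumford_tate G s M -> qsub M H) -> qsub G H.

Definition shimura_datum n (G : qgroup n) (X : set (dhom n)) :=
  [/\ reductive G,
      exists2 s, is_dhom G s & X = conj_class G s,
      forall s, X s -> [/\ hodge_type G s, cartan G s & no_trivial_factor G s] &
      mt_generated G X].

(* mu = mu_s, that is mu(z) = s_C(z, 1) under S(C) = C^* x C^*; it is
   characterized by s(z) = mu(z) * conj(mu(z)). *)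
Definition hodge_cochar n (s : dhom n) (mu : C -> 'M[C]_n) :=
  [/\ mu 1 = 1%:M,
      forall z w, z != 0 -> w != 0 -> mu (z * w) = mu z *m mu w,
      exists (k : nat) (P : 'I_n -> 'I_n -> {poly C}),
        forall z i j, z != 0 -> mu z i j = (P i j).[z] / z ^+ k,
      forall z w, z != 0 -> w != 0 ->
        mu z *m conjmx (mu w) = conjmx (mu w) *m mu z &
      forall z, z != 0 -> toC (s z) = mu z *m conjmx (mu z)].

(* The field of definition of the G(C)-conjugacy class of the mu_s. *)
Definition reflex n (G : qgroup n) (X : set (dhom n)) : set C :=
  [set c | forall sigma : {rmorphism C -> C}, bijective sigma ->
     (exists s mu g, [/\ X s, hodge_cochar s mu, qpts G C g &
        forall z, z != 0 ->
          map_mx sigma (mu z) = g *m mu (sigma z) *m invmx g]) ->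
     sigma c = c].

End ShimuraData.

Section Varieties.
Variable R : realType.
Local Notation C := R[i].

(* Points of projective space are nonzero vectors up to proportionality. *)
Definition proportional m (v w : 'rV[C]_m) := exists2 c : C, c != 0 & w = c *: v.

(* A quasi-projective variety: a locally closed subset of projective space. *)
Record qproj := QProj {
  qp_dim : nat;
  qp_eqs : set (mpoly.mpoly qp_dim.+1 C);
  qp_neqs : set (mpoly.mpoly qp_dim.+1 C) }.

Definition qp_mem (V : qproj) : set 'rV[C]_(qp_dim V).+1 :=
  [set v | [/\ v != 0, forall f, qp_eqs f -> ceval f v = 0 &
              exists2 f, qp_neqs f & ceval f v != 0]].

Definition homogeneous_over (F : set C) m (d : nat) (f : mpoly.mpoly m C) :=
  forall e, e \in mpoly.msupp f -> mpoly.mdeg e = d /\ F (mpoly.mcoeff e f).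

Definition qp_over (F : set C) (V : qproj) :=
  forall f, qp_eqs (q:=V) f \/ qp_neqs (q:=V) f -> exists d, homogeneous_over F d f.

Definition qp_rational (V : qproj) (L : set C) (v : 'rV[C]_(qp_dim V).+1) :=
  exists2 w : 'rV[C]_(qp_dim V).+1, (forall j, L (w 0 j)) & proportional w v.

(* The relation Phi between V and W is the graph of a morphism over F, i.e.
   is given, locally for the Zariski topology, by forms over F. *)
Definition regular_over (F : set C) (V W : qproj)
    (Phi : 'rV[C]_(qp_dim V).+1 -> 'rV[C]_(qp_dim W).+1 -> Prop) :=
  forall v, qp_mem v ->
    exists (d : nat) (f : 'I_(qp_dim W).+1 -> mpoly.mpoly (qp_dim V).+1 C),
      let F' (u : 'rV[C]_(qp_dim V).+1) := \row_j ceval (f j) u in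
      [/\ forall j, homogeneous_over F d (f j), F' v != 0 &
          forall u w, qp_mem u -> F' u != 0 -> Phi u w -> proportional w (F' u)].

Definition galois_point (sigma : {rmorphism Qbar R -> Qbar R}) m
    (v w : 'rV[C]_m) :=
  exists u : 'rV[Qbar R]_m,
    proportional (map_mx (@qbval R) u) v /\
    proportional (map_mx (fun x => qbval (sigma x)) u) w.

(* iota : X -> V(C) is a holomorphic immersion and an open map, that is an
   isomorphism locally on X.  The complex structure of X is the one for which
   the Hodge filtration varies holomorphically: the tangent space of X at s
   is the set of the w + conj(w), for w of type (-1, 1), and multiplication by
   'i on it is w + conj(w) |-> 'i w + conj('i w).  Nearby points of X are the
   conjugates of s by g in G(R) close to 1, and l is the derivative at g = 1 of
   the affine coordinates of iota(g s g^-1). *)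
Definition small n (e : R) (g : 'M[R]_n) := forall i j, `|g i j| <= e.

Definition analytic_iso n (G : qgroup n) (X : set (dhom R n)) (V : qproj)
    (iota : dhom R n -> 'rV[C]_(qp_dim V).+1) :=
  forall s i, X s -> iota s 0 i != 0 ->
    let coord (t : dhom R n) j := iota t 0 j / iota t 0 i in
    (exists l : 'I_(qp_dim V).+1 -> 'M[R]_n -> C,
      [/\ forall j (c : R) v w,
            l j (c *: v + w) = c%:C%C * l j v + l j w,
          forall j (e : R), 0 < e -> exists2 d : R, 0 < d &
            forall (r : R) g, 0 < r < d -> qpts G R g -> small r (g - 1%:M) ->
              ComplexField.Normc.normc
                (coord (conj_dhom g s) j - coord s j - l j (g - 1%:M))
                <= e * r,
          forall j w, hodge_piece G s (-1) w ->
            l j (map_mx (@complex.Re R) ('i%C *: w)) =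
            'i%C * l j (map_mx (@complex.Re R) w) &
          forall w, hodge_piece G s (-1) w ->
            (forall j, l j (map_mx (@complex.Re R) w) = 0) -> w = 0]) /\
    (forall d : R, 0 < d -> exists2 e : R, 0 < e &
       forall v : 'rV[C]_(qp_dim V).+1, qp_mem v -> v 0 i != 0 ->
         (forall j, ComplexField.Normc.normc (v 0 j / v 0 i - coord s j) < e) ->
         exists g, [/\ qpts G R g, small d (g - 1%:M) &
                       proportional (iota (conj_dhom g s)) v]).

End Varieties.

Section CanonicalModels.
Variables (R : realType) (cl : forall p, padic_closure R p).
Local Notation C := R[i].

(* Equality of [s, g] and [s', g'] in G(Q) \ X x G(A_f) / K. *)
Definition same_class n (G : qgroup n) (K : set (adele n))
    (s : dhom R n) (g : adele n) (s' : dhom R n) (g' : adele n) :=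
  exists q k, [/\ qpts G rat q, K k, s' = conj_dhom (map_mx ratr q) s &
                  g' = amul (arat q) (amul g k)].

(* The canonical models: for every datum and neat level, a variety Sh_K(G, X)
   with the parametrization (s, g) |-> [s, g] of its complex points.

   cm_special is the reciprocity law at special points.  For the torus T, let E
   be the field of definition of mu_s.  Class field theory identifies the
   action of A_E^* with the Galois action; since Frobenius elements are dense,
   it is enough to describe the action of the (arithmetic) Frobenius elements
   at almost all places v of E.  These act by the inverse of r(pi_v), where
   pi_v is the idele p at v and 1 elsewhere (v is unramified) and
   r(pi_v) in T(Q_p) is the product of the e(mu_s(p)) over the embeddings e
   of E which induce v.  The automorphisms in the list es of Gal(Qbar / Q) are
   representatives of these embeddings; there are [E_v : Q_p] of them. *)
Record canonical_models := CanonicalModels {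
  cm_var : forall n, qgroup n -> set (dhom R n) -> set (adele n) -> qproj R;
  cm_pt : forall n (G : qgroup n) X K,
    dhom R n -> adele n -> 'rV[C]_(qp_dim (cm_var G X K)).+1;
  cm_over : forall n (G : qgroup n) X K,
    shimura_datum G X -> neat_level cl G K ->
    qp_over (reflex G X) (cm_var G X K);
  cm_mem : forall n (G : qgroup n) X K s g,
    shimura_datum G X -> neat_level cl G K -> X s -> apts G g ->
    qp_mem (cm_pt G X K s g);
  cm_surj : forall n (G : qgroup n) X K v,
    shimura_datum G X -> neat_level cl G K ->
    @qp_mem R (cm_var G X K) v ->
    exists s g, [/\ X s, apts G g & proportional (cm_pt G X K s g) v];
  cm_class : forall n (G : qgroup n) X K s g s' g',
    shimura_datum G X -> neat_level cl G K ->
    X s -> apts G g -> X s' -> apts G g' ->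
    (proportional (cm_pt G X K s g) (cm_pt G X K s' g') <->
     same_class G K s g s' g');
  cm_analytic : forall n (G : qgroup n) X K g,
    shimura_datum G X -> neat_level cl G K -> apts G g ->
    analytic_iso G X (fun s => cm_pt G X K s g);
  cm_hecke : forall n (G : qgroup n) X K K' g,
    shimura_datum G X -> neat_level cl G K -> neat_level cl G K' ->
    apts G g -> (forall k, K' k -> K (amul (ainv g) (amul k g))) ->
    regular_over (reflex G X) (fun v w => exists s h,
      [/\ X s, apts G h, proportional (cm_pt G X K' s h) v &
          proportional (cm_pt G X K s (amul h g)) w]);
  cm_functor : forall m n (H : qgroup m) Y (G : qgroup n) X K' K phi,
    shimura_datum H Y -> shimura_datum G X ->
    neat_level cl H K' -> neat_level cl G K ->
    qhom H G phi -> (forall s, Y s -> X (app_dhom phi s)) ->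
    (forall k, K' k -> K (aapp phi k)) ->
    regular_over (compositum (reflex H Y) (reflex G X)) (fun v w => exists s h,
      [/\ Y s, apts H h, proportional (cm_pt H Y K' s h) v &
          proportional (cm_pt G X K (app_dhom phi s) (aapp phi h)) w]);
  cm_special : forall n (G : qgroup n) X K s g (T : qgroup n) mu,
    shimura_datum G X -> neat_level cl G K -> X s -> apts G g ->
    qsub T G -> is_torus R T -> (forall z, z != 0 -> qpts T R (s z)) ->
    hodge_cochar s mu ->
    let E := reflex T [set s] in
    exists B : nat, forall p, (B < pnat p)%N ->
      forall (tau sigma : {rmorphism Qbar R -> Qbar R})
             (es : seq {rmorphism Qbar R -> Qbar R})
             (a : 'M[Qbar R]_n) (r : adele n),
        Gal E sigma ->
        (forall e : {rmorphism Qbar R -> Qbar R}, same_place cl p E tau e ->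
           exists! i : 'I_(size es),
             forall x, E (qbval x) -> e x = nth tau es i x) ->
        (forall i : 'I_(size es), same_place cl p E tau (nth tau es i)) ->
        frobenius cl p tau (pnat p ^ size es) sigma ->
        map_mx (@qbval R) a = mu (pnat p)%:R ->
        (forall l, l <> p -> r l = 1%:M) ->
        map_mx (pc_in (cl p)) (r p) *m
          \big[mulmx/1%:M]_(e <- es) map_mx (fun x => pc_qbar (cl p) (e x)) a
          = 1%:M ->
        galois_point sigma (cm_pt G X K s g) (cm_pt G X K s (amul r g)) }.

(* rho is the representation attached to [s, 1] in Sh(G, X)(Qbar), the
   projective limit of the Sh_K'(G, X)(Qbar). *)
Definition galois_rep (Sh : canonical_models) n (G : qgroup n) X
    (K : set (adele n)) (L : set C) (s : dhom R n)
    (rho : {rmorphism Qbar R -> Qbar R} -> adele n) :=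
  [/\ forall sigma, Gal L sigma -> K (rho sigma),
      forall sigma tau : {rmorphism Qbar R -> Qbar R}, Gal L sigma -> Gal L tau ->
        rho (GRing.RMorphism.clone _ _ (sigma \o tau) _) =
          amul (rho sigma) (rho tau) &
      forall sigma K', Gal L sigma -> neat_level cl G K' ->
        galois_point sigma (cm_pt Sh G X K' s (aone n))
                           (cm_pt Sh G X K' s (rho sigma))].

(* K acts simply transitively on the fibre of Sh(G, X)(C) =
   G(Q) \ X x G(A_f) over [s, 1] in Sh_K(G, X)(C). *)
Definition simply_transitive n (G : qgroup n) (X : set (dhom R n))
    (K : set (adele n)) (s : dhom R n) :=
  let same := same_class G [set aone n] in
  forall s1 g1 s2 g2, X s1 -> apts G g1 -> X s2 -> apts G g2 ->
    same_class G K s (aone n) s1 g1 -> same_class G K s (aone n) s2 g2 ->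
    exists! k, K k /\ same s1 (amul g1 k) s2 g2.

End CanonicalModels.

(* Main.v *)
(* The inclusion of M in G gives morphisms Sh(M, X_M) -> Sh(G, X) over L'.  For
   sigma in Gal(Qbar / L'), extended to C, the conjugate of [s, 1] in
   Sh_{K cap M}(M, X_M) is some [s0, m0]; comparing it with [s, rho(sigma)] in
   Sh_K(G, X) gives q in G(Q) with s0 = q s and m0 = q rho(sigma) k.  As
   stabilizers in G(Q) of points of Sh(G, X) meet K trivially, the same q works
   at all deeper levels, so that q rho(sigma) is in the closed set M(A_f).

   The fibre of Sh_{K cap M}(M, X_M) over x is countable, hence [s, 1] is
   algebraic over L' there, and is fixed by some power sigma^j.  Then q = 1 for
   sigma^j, that is rho(sigma)^j is in M(A_f).

   It remains to extract l-th roots, for l prime.  If rho(sigma)^l is in M(A_f)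
   but rho(sigma) is not, then the rational q is not in M, so that no component
   rho(sigma)_p is in M(Q_p).  An equation f of M then gives the sequence
   f(rho(sigma)_p^k), which vanishes at the multiples of l but not at 1; being
   an exponential polynomial in the products of eigenvalues, this forces a
   nontrivial l-th root of unity in the group Gamma_p, for every p, against
   neatness. *)
Require Import Defs.
From HB Require Import structures.
From mathcomp Require Import all_boot all_order all_algebra.
From mathcomp Require Import complex.
From mathcomp Require Import all_classical all_reals all_analysis.
From mathcomp Require Import -(notations) mpoly.
From mathcomp Require Import generic_quotient separable ring zify.
Set Implicit Arguments.
Unset Strict Implicit.
Unset Printing Implicit Defensive.
Import Order.TTheory GRing.Theory Num.Theory.
Local Open Scope classical_set_scope.
Local Open Scope ring_scope.
Local Notation Zp := Defs.Zp.
Local Notation pnat := Defs.pnat.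
Local Notation qpoly := Defs.qpoly.

(** * Extension of field homomorphisms *)

(** Only the image x of [s, 1] in Sh_K(G, X) is supposed rational. Nothing is known at the outset
    about the coordinates of [s, 1] on Sh_{K cap M}(M, X_M), which are complex numbers: this is why
    sigma is extended to C before it is applied to them. The extension [tau] fixes L' and is merely
    a ring endomorphism of C; this suffices, since it is injective and carries along equations and
    forms whose coefficients it fixes. Countability of the fibre gives algebraicity because a
    coordinate ratio transcendental over L' could be sent, by such endomorphisms, to every element
    outside some proper subfield D of C; the complement of D is uncountable, whereas G(Q) is
    countable. The element q attached to sigma is not known to be multiplicative in sigma, so each
    root extraction uses a q produced afresh for the power of sigma at hand. *)

Section MinPoly.
Variables (K E : fieldType) (i : {rmorphism K -> E}).

(** The last clause is irreducibility, in the form that provides inverses through Bezout. If [P]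
    does not vanish at [x], neither does its gcd [g] with [p]; so [p] divides the cofactor of [g] in
    [p], and [g] is constant. *)
Lemma minimal_poly (x : E) : algebraicOver i x ->
  exists p : {poly K}, [/\ p != 0, root (map_poly i p) x,
    forall P, root (map_poly i P) x -> p %| P &
    forall P, ~~ root (map_poly i P) x -> coprimep P p].
Proof.
move=> [p0 p0nz p0x].
pose S n := `[< exists p : {poly K}, [/\ p != 0, root (map_poly i p) x & size p = n] >].
have exS : exists n, S n by exists (size p0); apply/asboolP; exists p0.
have [n /asboolP[p [pnz px pn]] nmin] := ex_minnP exS.
have dvd P : root (map_poly i P) x -> p %| P.
  move=> Px; apply/eqP; case: (eqVneq (P %% p) 0) => // rnz.
  have : root (map_poly i (P %% p)) x.
    have := Px; rewrite {1}(divp_eq P p) rmorphD rmorphM /= /root !hornerE.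
    by rewrite (eqP px) mulr0 add0r.
  move=> rx; have : (n <= size (P %% p)%R)%N.
    by apply: nmin; apply/asboolP; exists (P %% p).
  by rewrite -pn leqNgt ltn_modp pnz.
exists p; split=> // P Px.
rewrite /coprimep; set g := gcdp P p.
have gp : g %| p := dvdp_gcdr _ _.
have gnz : g != 0 by rewrite gcdp_eq0 (negbTE pnz) andbF.
have ngx : ~~ root (map_poly i g) x.
  apply: contra Px => gx; have /dvdpP[q ->] : g %| P := dvdp_gcdl _ _.
  by rewrite rmorphM /= rootM gx orbT.
have /dvdpP[q pq] := gp.
have qx : root (map_poly i q) x.
  by move: px; rewrite pq rmorphM /= rootM (negbTE ngx) orbF.
have /dvdp_leq : p %| q by exact: dvd.
have qnz : q != 0 by apply: contraNneq pnz => q0; rewrite pq q0 mul0r.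
move=> /(_ qnz); rewrite pq size_mul // => le.
have : (size q + size g <= size q + 1)%N.
  by apply: leq_trans (leqSpred _) _; rewrite addn1 ltnS.
by rewrite leq_add2l leq_eqVlt ltnS leqn0 size_poly_eq0 (negbTE gnz) orbF.
Qed.
End MinPoly.

Section FieldGraph.
Variable E : fieldType.

(* Graph of a homomorphism to [E] from a subfield of [E]. *)
Definition field_graph (H : set (E * E)) :=
  [/\ H 1, forall u v, H u -> H v -> H (u - v),
      forall u v, H u -> H v -> H (u * v),
      forall u, H u -> u.1 != 0 -> H (u.1^-1, u.2^-1) &
      forall u, H u -> u.1 = 0 -> u.2 = 0].

Variables (H : set (E * E)) (hH : field_graph H).

Lemma graph_unit u : H u -> u.1 != 0 -> u.2 != 0.
Proof.
case: hH => _ hB hM hV h0 Hu u1; apply/eqP => u2.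
(* If [u.2 = 0], then 1 minus the product of [u] and its inverse has components 0 and 1. *)
have H1 : H 1 by case: hH.
have := h0 (1 - (u * (u.1^-1, u.2^-1))) (hB _ _ H1 (hM _ _ Hu (hV _ Hu u1))).
rewrite /= divff // subrr u2 mul0r subr0 => /(_ erefl) /eqP.
by rewrite oner_eq0.
Qed.

Lemma pair_unitE (u : E * E) : (u \is a GRing.unit) = (u.1 != 0) && (u.2 != 0).
Proof. by rewrite -!unitfE. Qed.

Definition graph_mem & field_graph H : pred (E * E) := fun u => `[< H u >].

Lemma graph_divring : divring_closed (graph_mem hH).
Proof.
case: (hH) => h1 hB hM hV h0; split.
- exact/asboolP.
- by move=> u v /asboolP Hu /asboolP Hv; apply/asboolP; exact: hB.
move=> u v /asboolP Hu /asboolP Hv; apply/asboolP; apply: hM => //.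
(* If [v.1 = 0], then [v] is not a unit of [E * E] and is its own inverse there, by convention. *)
have [v1|v1] := eqVneq v.1 0.
  by rewrite invr_out // pair_unitE v1 eqxx.
have -> : v^-1 = (v.1^-1, v.2^-1); last exact: hV.
have v2 := graph_unit Hv v1.
apply: (@mulIr _ v); first by rewrite pair_unitE v1.
rewrite mulVr ?pair_unitE ?v1 //.
by congr (_, _); rewrite mulVf.
Qed.
HB.instance Definition _ := GRing.isDivringClosed.Build _ (graph_mem hH) graph_divring.

(** The graph itself becomes a field, isomorphic to the domain of the homomorphism: [gfst] is the
    inclusion of the domain and [gsnd] the homomorphism. *)
Record graph_field := GraphField { gval :> E * E; _ : gval \in graph_mem hH }.
HB.instance Definition _ := [isSub for gval].
HB.instance Definition _ := [Choice of graph_field by <:].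
HB.instance Definition _ := [SubChoice_isSubComUnitRing of graph_field by <:].
Lemma graph_fieldP : GRing.field_axiom graph_field.
Proof.
move=> u u0; rewrite unfold_in /= pair_unitE.
have Hu : H (val u) by apply/asboolP; exact: (valP u).
have u1 : (val u).1 != 0.
  apply: contraNneq u0 => u10; apply/eqP/val_inj.
  have [_ _ _ _ h0] := hH; have u20 := h0 _ Hu u10.
  by rewrite (surjective_pairing (val u)) u10 u20.
by rewrite u1 (graph_unit Hu u1).
Qed.
HB.instance Definition _ := GRing.ComUnitRing_isField.Build graph_field graph_fieldP.

Definition gfst : graph_field -> E := fst \o val.
HB.instance Definition _ := GRing.RMorphism.on gfst.
Definition gsnd : graph_field -> E := snd \o val.
HB.instance Definition _ := GRing.RMorphism.on gsnd.
End FieldGraph.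
Arguments gfst {E H} hH u.
Arguments gsnd {E H} hH u.

Lemma lift_poly (K E : nzRingType) (i : {rmorphism K -> E}) (p : {poly E}) :
  (forall k, exists a, p`_k = i a) -> exists q : {poly K}, p = map_poly i q.
Proof.
move=> /choice[f pf]; exists (\poly_(k < size p) f k).
apply/polyP => k; rewrite coef_map coef_poly.
case: ltnP => [_|le]; first by rewrite pf.
by rewrite (nth_default _ le) raddf0.
Qed.

Lemma horner_Bezout (K E : fieldType) (i : {rmorphism K -> E}) U V P p z :
  U * P + V * p = 1 -> root (map_poly i p) z ->
  (map_poly i U).[z] = (map_poly i P).[z]^-1.
Proof.
move=> UV pz; have := congr1 (fun q => (map_poly i q).[z]) UV.
rewrite rmorphD !rmorphM rmorph1 /= !hornerE (eqP pz) mulr0 addr0 => h.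
have Pz : (map_poly i P).[z] != 0.
  by apply/eqP => P0; move/eqP: h; rewrite P0 mulr0 eq_sym oner_eq0.
by apply: (mulIf Pz); rewrite h mulVf.
Qed.

Definition algebraic_in (E : fieldType) (A : set E) (x : E) :=
  exists p : {poly E}, [/\ p != 0, forall k, A p`_k & root p x].

Lemma algebraic_in_sub (E : fieldType) (A B : set E) x :
  A `<=` B -> algebraic_in A x -> algebraic_in B x.
Proof. by move=> AB [p [p0 Ap px]]; exists p; split=> // k; exact: AB. Qed.

Lemma algebraic_inP (K E : fieldType) (i : {rmorphism K -> E}) x :
  algebraic_in (range i) x <-> algebraicOver i x.
Proof.
split=> [[p [p0 Ap px]]|[q q0 qx]].
  have [q pq] : exists q : {poly K}, p = map_poly i q.
    by apply: lift_poly => k; have [a _ <-] := Ap k; exists a.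
  by exists q; rewrite -?pq // -(map_poly_eq0 i) -pq.
exists (map_poly i q); split; rewrite ?map_poly_eq0 // => k.
by rewrite coef_map; exists q`_k.
Qed.

Section Extension.
Variable E : closedFieldType.
Implicit Type H : set (E * E).

Lemma range_gfst H (hH : field_graph H) : range (gfst hH) = fst @` H.
Proof.
apply/seteqP; split=> [_ [u _ <-]|_ [u Hu <-]].
  by exists (val u) => //; apply/asboolP; exact: (valP u).
have Hu' : u \in graph_mem hH by exact/asboolP.
by exists (GraphField Hu').
Qed.

(** As [E] is algebraically closed, the conjugate of the minimal polynomial of [x] has a root [y],
    which becomes the image of [x]. Values of polynomials suffice for the new graph, since Bezout
    expresses inverses as such values. *)
Lemma graph_extend1 H (hH : field_graph H) x :
  algebraic_in (fst @` H) x ->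
  exists H', [/\ field_graph H', H `<=` H' & exists y, H' (x, y)].
Proof.
rewrite -(range_gfst hH) algebraic_inP => /minimal_poly[p [p0 px dvd cop]].
have [y py] : exists y, root (map_poly (gsnd hH) p) y.
  apply/closed_rootP; rewrite size_map_poly.
  rewrite -(size_map_poly (gfst hH)).
  have /closed_rootP : exists x, root (map_poly (gfst hH) p) x by exists x.
  by [].
pose ev P : E * E := ((map_poly (gfst hH) P).[x], (map_poly (gsnd hH) P).[y]).
have ev_dvd P : p %| P -> root (map_poly (gsnd hH) P) y.
  by move=> /dvdpP[q ->]; rewrite rmorphM /= rootM py orbT.
exists (range ev); split.
- split.
  + by exists 1; rewrite // /ev !rmorph1 !hornerE.
  + by move=> _ _ [P _ <-] [Q _ <-]; exists (P - Q); rewrite // /ev !rmorphB !hornerE.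
  + by move=> _ _ [P _ <-] [Q _ <-]; exists (P * Q); rewrite // /ev !rmorphM !hornerE.
  + move=> _ [P _ <-] /= Px.
    have /Bezout_eq1_coprimepP[[U V] /= UV] : coprimep P p by exact: cop.
    by exists U => //; rewrite /ev !(horner_Bezout UV).
  + move=> _ [P _ <-] /= /eqP Px; apply/eqP; apply: ev_dvd; exact: dvd.
- move=> u Hu; have Hu' : u \in graph_mem hH by exact/asboolP.
  exists (GraphField Hu')%:P => //.
  by rewrite /ev !map_polyC !hornerC /gfst /gsnd /= -surjective_pairing.
- exists y; exists 'X => //; by rewrite /ev !map_polyX !hornerX.
Qed.

Lemma hom_extend H : field_graph H -> (forall x, algebraic_in (fst @` H) x) ->
  exists f : {rmorphism E -> E}, forall u, H u -> f u.1 = u.2.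
Proof.
move=> hH0 algH.
(* The union with [H] makes the empty chain admissible in Zorn's lemma. *)
pose P S := field_graph (S `|` H).
have [F FP Ftot|A [PA Amax]] := @Zorn_bigcup _ P.
  have [F0|/set0P[X0 FX0]] := eqVneq F set0.
    by rewrite /P F0 bigcup_set0 set0U.
  have key u : (\bigcup_(X in F) X `|` H) u -> exists2 X, F X & (X `|` H) u.
    by case=> [[X FX Xu]|Hu]; [exists X => //; left|exists X0 => //; right].
  have key2 u v : (\bigcup_(X in F) X `|` H) u -> (\bigcup_(X in F) X `|` H) v ->
      exists X, [/\ F X, (X `|` H) u & (X `|` H) v].
    move=> /key[X FX Xu] /key[Y FY Yv].
    have [XY|YX] := Ftot _ _ FX FY.
      by exists Y; split=> //; case: Xu => [/XY|]; [left|right].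
    by exists X; split=> //; case: Yv => [/YX|]; [left|right].
  have back X : F X -> X `|` H `<=` (\bigcup_(X in F) X `|` H).
    by move=> FX u [Xu|]; [left; exists X|right].
  split.
  - by right; case: hH0.
  - move=> u v /key2 h /h[X [FX Xu Xv]]; apply: (back X) => //.
    by case: (FP _ FX) => _ hB _ _ _; exact: hB.
  - move=> u v /key2 h /h[X [FX Xu Xv]]; apply: (back X) => //.
    by case: (FP _ FX) => _ _ hB _ _; exact: hB.
  - move=> u /key[X FX Xu] u1; apply: (back X) => //.
    by case: (FP _ FX) => _ _ _ hB _; exact: hB.
  - move=> u /key[X FX Xu]; by case: (FP _ FX) => _ _ _ _; apply.
have tot x : exists y, (A `|` H) (x, y).
  apply: contrapT => nx.
  have [|H' [hH' HH' [y H'xy]]] := graph_extend1 PA (x := x).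
    apply: algebraic_in_sub (algH x); exact/image_subset/subsetUr.
  apply: (Amax H'); last first.
    by rewrite /P setUidl // => u Hu; apply: HH'; right.
  split; first by move=> u Au; apply: HH'; left.
  by move=> /(_ _ H'xy) Axy; apply: nx; exists y; left.
have [f fP] := choice tot.
have [h1 hB hM hV h0] := PA.
have fun_eq x y : (A `|` H) (x, y) -> f x = y.
  move=> Hxy; have := h0 _ (hB _ _ (fP x) Hxy).
  by rewrite /= subrr => /(_ erefl) /eqP; rewrite subr_eq0 => /eqP.
have fB : zmod_morphism f by move=> x y; apply: fun_eq; exact: (hB _ _ (fP x) (fP y)).
have fM : monoid_morphism f.
  by split=> [|x y]; apply: fun_eq => //; exact: (hM _ _ (fP x) (fP y)).
pose fZ := GRing.isZmodMorphism.Build E E f fB.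
pose fR := GRing.isMonoidMorphism.Build E E f fM.
pose g : {rmorphism E -> E} := HB.pack f fZ fR.
by exists g => -[x y] Hu /=; apply: fun_eq; right.
Qed.
End Extension.

(** * Subfields, exchange and transcendental elements *)

Section Subfields.
Variable E : fieldType.
Implicit Types A D F : set E.

Definition subfield A :=
  [/\ A 1, forall x y, A x -> A y -> A (x - y) &
      forall x y, A x -> A y -> A (x / y)].

Lemma subfield0 A : subfield A -> A 0.
Proof. by case=> A1 AB _; rewrite -(subrr 1); exact: AB. Qed.

Lemma subfieldN A : subfield A -> forall x, A x -> A (- x).
Proof. by move=> hA x Ax; rewrite -sub0r; case: (hA) => _ AB _; apply: AB => //; exact: subfield0. Qed.

Lemma subfieldD A : subfield A -> forall x y, A x -> A y -> A (x + y).
Proof.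
move=> hA x y Ax Ay; rewrite -[y]opprK; case: (hA) => _ AB _.
by apply: AB => //; exact: subfieldN.
Qed.

Lemma subfieldM A : subfield A -> forall x y, A x -> A y -> A (x * y).
Proof.
move=> hA x y Ax Ay; have [A1 _ AV] := hA.
have Vy := AV _ _ A1 Ay; rewrite div1r in Vy.
by rewrite -[y]invrK; exact: (AV _ _ Ax Vy).
Qed.

Lemma subfield_nat A : subfield A -> forall n, A n%:R.
Proof.
move=> hA; elim=> [|n IH]; first exact: subfield0.
by rewrite -natr1; apply: subfieldD => //; case: hA.
Qed.

(** The field type is the graph of the identity of [A]; it gives access to polynomials with
    coefficients in [A]. *)
Lemma subfield_field A : subfield A ->
  exists (K : fieldType) (i : {rmorphism K -> E}), range i = A.
Proof.
move=> hA; pose H := [set u : E * E | A u.1 /\ u.2 = u.1].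
have hH : field_graph H.
  have [A1 AB AV] := hA.
  split=> [//|u v [Au eu] [Av ev]|u v [Au eu] [Av ev]|u [Au eu] _|u [Au ->]] //.
  - by split=> /=; [exact: AB|rewrite eu ev].
  - by split=> /=; [exact: subfieldM|rewrite eu ev].
  - by split=> /=; [rewrite -div1r; exact: AV|rewrite eu].
exists (graph_field hH), (gfst hH); apply/seteqP; split=> [_ [u _ <-]|x Ax].
  by have /asboolP[] : val u \in graph_mem hH := valP u.
have Hx : (x, x) \in graph_mem hH by exact/asboolP.
by exists (GraphField Hx).
Qed.

Lemma algebraic_in_mem A x : subfield A -> A x -> algebraic_in A x.
Proof.
move=> hA Ax; exists ('X - x%:P); split; rewrite ?polyXsubC_eq0 ?root_XsubC //.
move=> k; rewrite coefB coefX coefC; case: hA => A1 AB AV.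
have A0 : A 0 by rewrite -(subrr 1); exact: AB.
by apply: AB; case: (k == _) => //; case: (k == _).
Qed.

Lemma algebraic_in_trans (K : fieldType) (i : {rmorphism K -> E}) A x :
  (forall a, A a -> algebraicOver i a) -> algebraic_in A x -> algebraicOver i x.
Proof.
move=> AK [p [p0 Ap px]]; apply/integral_algebraic.
apply: (integral_root p0 px) => c /(nthP 0)[k _ <-].
by apply/integral_algebraic/AK.
Qed.

(** A condition on finite families of elements passes to unions of chains. It serves twice below:
    for the transcendence of a given element over [D], and for the absence in [D] of new elements
    algebraic over [F]. *)
Lemma subfield_zorn F (q : seq E -> Prop) : subfield F ->
  (forall s, {in s, forall x, F x} -> q s) ->
  exists D, [/\ subfield D, F `<=` D, forall s, {in s, forall x, D x} -> q s &
    forall D', subfield D' -> D `<=` D' ->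
      (forall s, {in s, forall x, D' x} -> q s) -> D' `<=` D].
Proof.
move=> hF qF.
pose P S := subfield (S `|` F) /\
  forall s, {in s, forall x, (S `|` F) x} -> q s.
have [C CP Ctot|D [[hD qD] Dmax]] := @Zorn_bigcup _ P.
  have [C0|/set0P[X0 CX0]] := eqVneq C set0.
    by rewrite /P C0 bigcup_set0 set0U.
  set U := \bigcup_(X in C) X `|` F.
  have key u : U u -> exists2 X, C X & (X `|` F) u.
    by case=> [[X CX Xu]|Hu]; [exists X => //; left|exists X0 => //; right].
  have dir X Y : C X -> C Y -> exists Z, [/\ C Z, X `|` F `<=` Z `|` F & Y `|` F `<=` Z `|` F].
    move=> CX CY; have [XY|YX] := Ctot _ _ CX CY.
      by exists Y; split=> //; exact: setSU.
    by exists X; split=> //; exact: setSU.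
  have back X : C X -> X `|` F `<=` U.
    by move=> FX u [Xu|]; [left; exists X|right].
  split; first split.
  - by right; case: hF.
  - move=> u v /key[X CX Xu] /key[Y CY Yv].
    have [Z [CZ XZ YZ]] := dir _ _ CX CY; apply: (back Z) => //.
    by have [[_ B _] _] := CP _ CZ; apply: B; [exact: XZ|exact: YZ].
  - move=> u v /key[X CX Xu] /key[Y CY Yv].
    have [Z [CZ XZ YZ]] := dir _ _ CX CY; apply: (back Z) => //.
    by have [[_ _ B] _] := CP _ CZ; apply: B; [exact: XZ|exact: YZ].
  - move=> s sU.
    suff [X CX sX] : exists2 X, C X & {in s, forall x, (X `|` F) x}.
      by have [_] := CP _ CX; apply.
    elim: s sU => [_|a s IH sU]; first by exists X0.
    have [x xs|X CX sX] := IH; first by apply: sU; rewrite inE xs orbT.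
    have [Y CY Ya] := key a (sU a (mem_head _ _)).
    have [Z [CZ XZ YZ]] := dir _ _ CX CY; exists Z => // x.
    by rewrite inE => /orP[/eqP->|xs]; [exact: YZ|apply/XZ/sX].
exists (D `|` F); split=> //.
move=> D' hD' DD' qD'; apply: contrapT => nDD'.
have DF : D' `|` F = D' by apply/setUidl => x Fx; apply: DD'; right.
apply: (Dmax D'); last by rewrite /P DF.
split; first by move=> x Dx; apply: DD'; left.
by move=> D'D; apply: nDD' => x /D'D; left.
Qed.

Section Adjoin.
Variables (K : fieldType) (i : {rmorphism K -> E}).
Local Notation "p ^i" := (map_poly i p) (at level 2, format "p ^i").

Definition adjoin x : set E :=
  [set z | exists p q : {poly K}, q^i.[x] != 0 /\ z = p^i.[x] / q^i.[x]].

Lemma subfield_adjoin x : subfield (adjoin x).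
Proof.
split.
- exists 1, 1; rewrite rmorph1 hornerE oner_neq0; split=> //.
  by rewrite divr1.
- move=> _ _ [p [q [qx ->]]] [p' [q' [q'x ->]]].
  exists (p * q' - p' * q), (q * q').
  rewrite !(rmorphB, rmorphM) /= !hornerE mulf_neq0 //; split=> //.
  by rewrite -mulNr addf_div // mulNr.
- move=> _ _ [p [q [qx ->]]] [p' [q' [q'x ->]]].
  have [p'0|p'0] := eqVneq p'^i.[x] 0.
    exists 0, 1; rewrite rmorph1 rmorph0 !hornerE oner_neq0; split=> //.
    by rewrite p'0 mul0r invr0 mulr0.
  exists (p * q'), (q * p'); rewrite !rmorphM !hornerE mulf_neq0 //; split=> //.
  by rewrite invf_div mulf_div.
Qed.

Lemma adjoin_horner x p : adjoin x p^i.[x].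
Proof. by exists p, 1; rewrite rmorph1 hornerE oner_neq0 divr1. Qed.

Lemma adjoin_base x : range i `<=` adjoin x.
Proof.
by move=> _ [a _ <-]; have := adjoin_horner x a%:P; rewrite map_polyC hornerC.
Qed.

Lemma adjoin_gen x : adjoin x x.
Proof. by have := adjoin_horner x 'X; rewrite map_polyX hornerX. Qed.

Lemma algebraic_adjoin x z : algebraicOver i x -> adjoin x z -> algebraicOver i z.
Proof.
move=> hx.
have ev p : algebraicOver i p^i.[x].
  elim/poly_ind: p => [|p c IH].
    by rewrite rmorph0 horner0; exact: algebraic0.
  rewrite rmorphD rmorphM /= map_polyX map_polyC !hornerE.
  by apply: algebraic_add; [exact: algebraic_mul|exact: algebraic_id].
by move=> [p [q [_ ->]]]; exact: algebraic_div.
Qed.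

(** Steinitz exchange: an equation of [y] over K(x), cleared of denominators, is a polynomial
    relation between [x] and [y] over [K], which is read as an equation of [x] over K(y). *)
Lemma algebraic_exchange x y : ~ algebraicOver i y ->
  algebraic_in (adjoin x) y -> algebraic_in (adjoin y) x.
Proof.
move=> ny [p [p0 /choice[P]]] /[swap] py.
move=> /choice[Q PQ].
pose n := size p.
(* A common denominator of the coefficients of [p]; [A k] is the numerator over it of the
   coefficient of index [k]. *)
pose d := \prod_(k < n) Q k.
pose A (k : nat) : {poly K} := P k * \prod_(l < n | l != k :> nat) Q l.
have dx : d^i.[x] != 0.
  rewrite /d rmorph_prod /= horner_prod; apply/prodf_neq0 => k _.
  by case: (PQ k).
have Ax (k : 'I_n) : (A k)^i.[x] = d^i.[x] * p`_k.
  have [Qk ->] := PQ k.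
  have -> : d = Q k * \prod_(l < n | l != k :> nat) Q l by rewrite /d (bigD1 k).
  rewrite /A !rmorphM /= !hornerM mulrACA [_ / _]mulrC [RHS]mulrACA.
  by rewrite mulfV // mul1r mulrC.
(* [d * p] evaluated at [y], with [x] turned back into the variable. *)
pose T := \sum_(k < n) (y ^+ k) *: (A k)^i.
have Tx : root T x.
  rewrite /root /T horner_sum.
  have -> : \sum_(k < n) (y ^+ k *: (A k)^i).[x] = d^i.[x] * p.[y].
    rewrite (horner_coef p) mulr_sumr; apply: eq_bigr => k _.
    by rewrite hornerZ Ax mulrC mulrA.
  by rewrite (eqP py) mulr0.
(* The coefficient of degree [j] in [x], as a polynomial in [y]. Since [y] is transcendental,
   [T = 0] would force every [B j] to vanish, hence every [A k], hence [p]. *)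
pose B j := \poly_(k < n) (A k)`_j.
have TB j : T`_j = (B j)^i.[y].
  rewrite /T coef_sum (@horner_coef_wide _ n); last first.
    by rewrite size_map_poly; exact: size_poly.
  apply: eq_bigr => k _.
  by rewrite coefZ !coef_map coef_poly ltn_ord mulrC.
exists T; split=> //; last by move=> j; rewrite TB; exact: adjoin_horner.
apply: contra_notN ny => /eqP T0.
have [B0|/existsNP[j /eqP Bj]] := pselect (forall j, B j = 0); last first.
  by exists (B j) => //; rewrite /root -TB T0 coef0.
suff : p = 0 by move/eqP: p0.
apply/polyP => k; rewrite coef0.
have [kn|nk] := ltnP k n; last by rewrite nth_default.
have Ak : A k = 0.
  apply/polyP => j; have /polyP/(_ k) := B0 j.
  by rewrite coef_poly kn !coef0.
by have := Ax (Ordinal kn); rewrite Ak rmorph0 horner0 => /esym/eqP; rewrite mulf_eq0 (negbTE dx) => /eqP.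
Qed.
End Adjoin.
End Subfields.

Section Homs.
Variable E : closedFieldType.
Implicit Types D F : set E.

(* [D] is such that [E] is algebraic over [D(y)] and [D] is algebraically
   closed in [E]. *)
Lemma transcendental_homs F y : subfield F -> ~ algebraic_in F y ->
  exists D, [/\ subfield D, F `<=` D, ~ D y &
    forall y', ~ D y' -> exists f : {rmorphism E -> E},
      (forall z, D z -> f z = z) /\ f y = y'].
Proof.
move=> hF nFy.
(* A sequence lists the coefficients of a polynomial, so that transcendence of [y] is a condition on
   finite sequences. *)
pose q (s : seq E) := ~ (Poly s != 0 /\ root (Poly s) y).
have qP D : subfield D -> (forall s, {in s, forall x, D x} -> q s) <-> ~ algebraic_in D y.
  move=> hD; split=> [qD [p [p0 Dp py]]|nD s Ds [s0 sy]].
    by apply: (qD p); rewrite /q ?polyseqK // => x /(nthP 0)[k _ <-].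
  apply: nD; exists (Poly s); split=> // k; rewrite coef_Poly.
  have [ks|sk] := ltnP k (size s); first exact/Ds/mem_nth.
  by rewrite nth_default //; exact: subfield0.
have [D [hD FD /(qP _ hD) nDy Dmax]] := subfield_zorn hF (proj2 (qP _ hF) nFy).
have [K [i iD]] := subfield_field hD.
have ny : ~ algebraicOver i y by rewrite -algebraic_inP iD.
(* Adjoining an [x] outside [D] must destroy the transcendence of [y]. Hence [x] is itself
   transcendental over [D] and, by exchange, algebraic over D(y). *)
have maxD x : ~ D x -> algebraic_in (adjoin i x) y.
  move=> nDx; apply: contrapT => n; apply: nDx; apply: (Dmax (adjoin i x)).
  - exact: subfield_adjoin.
  - by rewrite -iD; exact: adjoin_base.
  - exact/qP/n/subfield_adjoin.
  - exact: adjoin_gen.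
have trans x : ~ D x -> ~ algebraicOver i x.
  move=> nDx ax; apply: ny; apply: algebraic_in_trans (maxD x nDx) => z.
  exact: algebraic_adjoin.
have algy x : algebraic_in (adjoin i y) x.
  have [Dx|nDx] := pselect (D x).
    apply: algebraic_in_mem; first exact: subfield_adjoin.
    by apply: adjoin_base; rewrite iD.
  exact/algebraic_exchange/maxD.
have nroot x p : ~ algebraicOver i x -> p != 0 -> (map_poly i p).[x] != 0.
  by move=> nx p0; apply: contra_notN nx => px; exists p.
exists D; split=> // [Dy|y' /trans ny'].
  by apply: nDy; exact: algebraic_in_mem.
pose ev p z := (map_poly i p).[z].
(* The isomorphism of D(y) with D(y') over [D], which [hom_extend] applies to because [E] is
   algebraic over D(y). *)
pose H := [set u : E * E | exists p q, q != 0 /\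
  u = (ev p y / ev q y, ev p y' / ev q y')].
have H0 p r : H (ev p y / ev r y, ev p y' / ev r y').
  have [->|r0] := eqVneq r 0; last by exists p, r.
  by exists 0, 1; rewrite oner_neq0 /ev !rmorph0 !horner0 invr0 !mulr0 !mul0r.
have [||f fH] := @hom_extend E H.
- split.
  + by have := H0 1 1; rewrite /ev rmorph1 !hornerE ?divr1 ?invr1 ?mulr1.
  + move=> _ _ [p [r [r0 ->]]] [p' [r' [r'0 ->]]].
    have := H0 (p * r' - p' * r) (r * r').
    rewrite /ev !(rmorphB, rmorphM) /= !hornerE.
    by congr H; congr (_, _); rewrite -mulNr -addf_div ?mulNr //; exact: nroot.
  + move=> _ _ [p [r [r0 ->]]] [p' [r' [r'0 ->]]].
    have := H0 (p * p') (r * r'); rewrite /ev !rmorphM !hornerE.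
    by congr H; congr (_, _); rewrite /= mulf_div.
  + move=> _ [p [r [r0 ->]]] _; have := H0 r p.
    by congr H; congr (_, _); rewrite /= invf_div.
  + move=> _ [p [r [r0 ->]]] /eqP /=.
    have [->|p0] := eqVneq p 0; first by rewrite /ev rmorph0 !horner0 !mul0r.
    by rewrite mulf_eq0 invr_eq0 (negbTE (nroot _ _ ny p0)) (negbTE (nroot _ _ ny r0)).
- move=> x; apply: algebraic_in_sub (algy x) => z [p [r [_ ->]]].
  by exists (ev p y / ev r y, ev p y' / ev r y').
exists f; split=> [z|].
  rewrite -iD => -[a _ <-]; have := fH _ (H0 a%:P 1).
  by rewrite /ev rmorph1 /= !map_polyC !hornerE ?divr1.
by have := fH _ (H0 'X 1); rewrite /ev /= !map_polyX rmorph1 !hornerE !divr1.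
Qed.

(** [D] behaves like the field generated over [F] by a transcendence basis; maximality replaces the
    basis. If some [x] were transcendental over [D], then D(x) would contain no new element
    algebraic over [F] either. *)
Lemma purely_transcendental F : subfield F ->
  exists D, [/\ subfield D, F `<=` D, forall x, D x -> algebraic_in F x -> F x &
    forall x, algebraic_in D x].
Proof.
move=> hF; have [K0 [i0 i0F]] := subfield_field hF.
pose q (s : seq E) := {in s, forall x, algebraic_in F x -> F x}.
have [|D [hD FD qD Dmax]] := @subfield_zorn E F q hF.
  by move=> s sF x /sF.
have {}qD x : D x -> algebraic_in F x -> F x.
  move=> Dx; apply: (qD [:: x]); last exact: mem_head.
  by move=> z; rewrite inE => /eqP->.
exists D; split=> // x; apply: contrapT => nDx.
have [K [i iD]] := subfield_field hD.
have nx : ~ algebraicOver i x by rewrite -algebraic_inP iD.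
have algF z : algebraic_in F z -> algebraicOver i z.
  by move=> h; apply/algebraic_inP; rewrite iD; exact: algebraic_in_sub h.
apply: nDx; apply: algebraic_in_mem => //.
apply: (Dmax (adjoin i x)).
- exact: subfield_adjoin.
- by rewrite -iD; exact: adjoin_base.
- move=> s sD z /sD [p [q' [qx zE]]] algz; apply: qD => //.
  (* If [z] is algebraic over [F], this polynomial has coefficients algebraic over [D] and vanishes
     at the transcendental [x]. So it is zero, and [z] is a quotient of coefficients. *)
  have zx : root (map_poly i p - z *: map_poly i q') x.
    by rewrite /root !hornerE zE divfK ?subrr.
  have /eqP : map_poly i p - z *: map_poly i q' == 0.
    apply: contra_notT nx => nz.
    apply/integral_algebraic; apply: (integral_root nz zx) => c /(nthP 0)[k _ <-].
    apply/integral_algebraic; rewrite coefB coefZ !coef_map.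
    apply: algebraic_sub; first exact: algebraic_id.
    by apply: algebraic_mul; [exact: algF|exact: algebraic_id].
  move/eqP; rewrite subr_eq0 => /eqP/polyP/(_ (size q').-1).
  rewrite coefZ !coef_map -/(lead_coef q') => e.
  have q0 : q' != 0 by apply: contraNneq qx => ->; rewrite rmorph0 horner0.
  have -> : z = i (p`_(size q').-1 / lead_coef q').
    by rewrite fmorph_div e mulfK // fmorph_eq0 lead_coef_eq0.
  by rewrite -iD; exists (p`_(size q').-1 / lead_coef q').
- exact: adjoin_gen.
Qed.
End Homs.

(** * Extension of automorphisms of Qbar to C *)

Section QbarExtension.
Variables (E : numClosedFieldType) (A : fieldType).
Variables (j : {rmorphism A -> E}) (sigma : {rmorphism A -> A}).
Hypothesis jP : forall x, algebraicOver (@ratr E) x <-> range j x.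

Lemma subfield_ratr (F : set E) r : subfield F -> F (ratr r).
Proof.
move=> hF; have [_ _ FV] := hF.
have Fz (z : int) : F z%:~R.
  case: z => n; first by rewrite -pmulrn; exact: subfield_nat.
  rewrite NegzE mulrNz -pmulrn; apply: subfieldN => //; exact: subfield_nat.
by rewrite /ratr; exact: FV.
Qed.

Lemma algebraic_ratr (F : set E) b : subfield F -> algebraic_in F (j b).
Proof.
move=> hF; have /jP/algebraic_inP : range j (j b) by exists b.
by apply: algebraic_in_sub => _ [r _ <-]; exact: subfield_ratr.
Qed.

Lemma ratr_fixed a r : j a = ratr r -> j (sigma a) = ratr r.
Proof.
move=> ar; suff -> : sigma a = a by [].
have [d0 e] : (denq r)%:~R != 0 :> A /\ a * (denq r)%:~R = (numq r)%:~R.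
  have d0 : (denq r)%:~R != 0 :> E by rewrite intr_eq0 denq_neq0.
  split; first by rewrite -(fmorph_eq0 j) rmorph_int.
  apply: (fmorph_inj j); rewrite rmorphM !rmorph_int /= ar.
  by rewrite /ratr divfK.
apply: (mulIf d0); rewrite e -[in LHS](rmorph_int sigma) -rmorphM e.
by rewrite rmorph_int.
Qed.

Lemma sigma_horner (u : {poly rat}) e a :
  (map_poly ratr u).[j e] = j a -> (map_poly ratr u).[j (sigma e)] = j (sigma a).
Proof.
have [v uv] : exists v, map_poly (@ratr E) u = map_poly j v.
  apply: lift_poly => k; rewrite coef_map /=.
  have /jP[a' _ <-] : algebraicOver (@ratr E) (ratr u`_k) by exact: algebraic_id.
  by exists a'.
have vs : map_poly j v = map_poly (j \o sigma) v.
  apply/polyP => k; rewrite !coef_map /=.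
  have /polyP/(_ k) := uv; rewrite !coef_map /= => /esym e'.
  by rewrite (ratr_fixed e') e'.
rewrite uv horner_map => /fmorph_inj <-.
by rewrite vs -[j (sigma e)]/((j \o sigma) e) horner_map.
Qed.

(** The minimal polynomial over [D] of an algebraic number has coefficients that are algebraic
    numbers of [D], hence elements of [F], and [sigma] fixes these. So [sigma] respects the
    relations over [D] and extends to the composite of [D] and Qbar with [D] fixed, and from there
    to [E]. *)
Lemma extend_sigma (F : set E) : subfield F ->
  (forall b, F (j b) -> sigma b = b) ->
  exists f : {rmorphism E -> E},
    (forall z, F z -> f z = z) /\ forall b, f (j b) = j (sigma b).
Proof.
move=> hF sF; have [D [hD FD Dpure algD]] := purely_transcendental hF.
have [K [i iD]] := subfield_field hD.
have root_sigma P b : root (map_poly i P) (j b) ->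
    root (map_poly i P) (j (sigma b)).
  have /algebraic_inP/minimal_poly[p [p0 pb dvd _]] : algebraic_in (range i) (j b).
    by rewrite iD; exact: algD.
  move=> /dvd; suff psb : root (map_poly i p) (j (sigma b)).
    by case/dvdpP => Q ->; rewrite rmorphM rootM psb orbT.
  pose p1 := (lead_coef p)^-1 *: p.
  have p1p z : root (map_poly i p1) z = root (map_poly i p) z.
    by rewrite map_polyZ rootZ // fmorph_eq0 invr_eq0 lead_coef_eq0.
  rewrite -p1p.
  (* The minimal polynomial divides one with rational coefficients; its roots are therefore in the
     image of [j], and so are its coefficients. *)
  have [p2 p2E] : exists p2, map_poly i p1 = map_poly j p2.
    have [cs csE] := closed_field_poly_normal (map_poly i p1).
    have mon : lead_coef (map_poly i p1) = 1.
      by rewrite lead_coef_map lead_coefZ mulVf ?rmorph1 ?lead_coef_eq0.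
    have [r r0 rb] : algebraicOver (@ratr E) (j b) by apply/jP; exists b.
    have [r1 r1E] : exists r1, map_poly (@ratr E) r = map_poly i r1.
      apply: lift_poly => k; rewrite coef_map.
      have : range i (ratr r`_k) by rewrite iD; exact: subfield_ratr.
      by case=> a _ ar; exists a; rewrite ar.
    have pr : p %| r1 by apply: dvd; rewrite -r1E.
    have csA c : c \in cs -> exists b, c = j b.
      move=> ccs; have : root (map_poly i p1) c.
        by rewrite csE mon scale1r root_prod_XsubC.
      rewrite p1p => pc; have /jP[b' _ <-] : algebraicOver (@ratr E) c.
        exists r => //; rewrite r1E; have /dvdpP[Q ->] := pr.
        by rewrite rmorphM rootM pc orbT.
      by exists b'.
    have [bs bsE] : exists bs, cs = map j bs.
      elim: cs csA {csE} => [|c cs IH] csA; first by exists [::].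
      have [|bs ->] := IH; first by move=> x xcs; apply: csA; rewrite inE xcs orbT.
      have [b' ->] := csA c (mem_head _ _).
      by exists (b' :: bs).
    exists (\prod_(b <- bs) ('X - b%:P)).
    rewrite csE mon scale1r bsE big_map rmorph_prod; apply: eq_bigr => b' _.
    by rewrite rmorphB /= map_polyX map_polyC.
  have fixc : map_poly j p2 = map_poly (j \o sigma) p2.
    apply/polyP => k; rewrite !coef_map /= sF //.
    apply: Dpure; last exact: algebraic_ratr.
    rewrite -iD; exists p1`_k => //.
    by have /polyP/(_ k) := p2E; rewrite !coef_map.
  rewrite p2E fixc -[j (sigma b)]/((j \o sigma) b).
  by rewrite fmorph_root -(fmorph_root j) -p2E p1p.
pose ev P b : E * E := ((map_poly i P).[j b], (map_poly i P).[j (sigma b)]).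
pose H := [set u | exists P b, u = ev P b].
(* By the primitive element theorem [b] and [c] are rational polynomials in one [e]; hence the
   values at single elements are closed under the field operations. *)
have dir b c : exists e u v, [/\ forall T, ev (T \Po u) e = ev T b & forall T, ev (T \Po v) e = ev T c].
  have [r r0 rb] : algebraicOver (@ratr E) (j b) by apply/jP; exists b.
  have [s s0 sc] : algebraicOver (@ratr E) (j c) by apply/jP; exists c.
  have [n [[u ub] [v vc]]] := pchar0_PET r0 rb s0 sc (pchar_num _).
  pose e := c *+ n - b.
  have je : j e = j c *+ n - j b by rewrite rmorphB rmorphMn.
  rewrite -je in ub vc.
  have lift w : exists w' : {poly K}, map_poly (@ratr E) w = map_poly i w'.
    apply: lift_poly => k; rewrite coef_map.
    have : range i (ratr w`_k) by rewrite iD; exact: subfield_ratr.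
    by case=> a _ ar; exists a; rewrite ar.
  have [[u' u'E] [v' v'E]] := (lift u, lift v).
  exists e, u', v'; split=> T; rewrite /ev !map_comp_poly !horner_comp -?u'E -?v'E.
    by rewrite ub (sigma_horner ub).
  by rewrite vc (sigma_horner vc).
have [||f fH] := @hom_extend E H.
- split.
  + by exists 1, 0; rewrite /ev rmorph1 !hornerE.
  + move=> _ _ [P [b ->]] [Q [c ->]].
    have [e [u [v [<- <-]]]] := dir b c.
    exists (P \Po u - (Q \Po v)), e.
    have hB z : (map_poly i (P \Po u - (Q \Po v))).[z] =
        (map_poly i (P \Po u)).[z] - (map_poly i (Q \Po v)).[z].
      by rewrite rmorphB !hornerE.
    by rewrite /ev !hB.
  + move=> _ _ [P [b ->]] [Q [c ->]].
    have [e [u [v [<- <-]]]] := dir b c.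
    exists ((P \Po u) * (Q \Po v)), e.
    have hM z : (map_poly i ((P \Po u) * (Q \Po v))).[z] =
        (map_poly i (P \Po u)).[z] * (map_poly i (Q \Po v)).[z].
      by rewrite rmorphM !hornerE.
    by rewrite /ev !hM.
  + move=> _ [P [b ->]] /= Pb.
    have /algebraic_inP/minimal_poly[p [p0 pb dvd cop]] : algebraic_in (range i) (j b).
      by rewrite iD; exact: algD.
    have /cop/Bezout_eq1_coprimepP[[U V] /= UV] : ~~ root (map_poly i P) (j b) by [].
    exists U, b; rewrite /ev (horner_Bezout UV pb).
    by rewrite (horner_Bezout UV (root_sigma _ _ pb)).
  + move=> _ [P [b ->]] /= /eqP Pb; apply/eqP; exact: root_sigma.
- move=> x; apply: algebraic_in_sub (algD x) => z.
  rewrite -iD => -[a _ <-]; exists (ev a%:P 0); first by exists a%:P, 0.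
  by rewrite /ev /= map_polyC hornerC.
exists f; split=> [z Fz|b].
  have : range i z by rewrite iD; exact: FD.
  case=> a _ <-; have /fH : H (ev a%:P 0) by exists a%:P, 0.
  by rewrite /ev /= !map_polyC !hornerC.
have /fH : H (ev 'X b) by exists 'X, b.
by rewrite /ev /= !map_polyX !hornerX.
Qed.
End QbarExtension.

(** * Eigenvalues and linear recurrences *)

Section Recurrences.
Variable F : fieldType.
Implicit Types (s t : seq F) (u v w : nat -> F).

(* The product of the [S - mu] for mu in [s], with S the shift, kills [u]. *)
Fixpoint killed s u : Prop :=
  if s is mu :: s' then killed s' (fun k => u k.+1 - mu * u k)
  else forall k, u k = 0.

Lemma killed_lin s a u v : killed s u -> killed s v ->
  killed s (fun k => a * u k + v k).
Proof.
elim: s u v => [|mu s IH] u v /= hu hv; first by move=> k; rewrite hu hv mulr0 addr0.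
have -> : (fun k => a * u k.+1 + v k.+1 - mu * (a * u k + v k)) =
    (fun k => a * (u k.+1 - mu * u k) + (v k.+1 - mu * v k)).
  by apply/funext => k; rewrite mulrBr mulrDr opprD addrACA mulrCA.
exact: IH.
Qed.

Lemma killed0 s : killed s (fun=> 0).
Proof.
elim: s => [|mu s IH] //=.
by have -> : (fun _ : nat => 0 - mu * 0) = fun=> 0 by apply/funext=> k; rewrite mulr0 subr0.
Qed.

Lemma killed_scale s a u : killed s u -> killed s (fun k => a * u k).
Proof.
move=> hu; have := killed_lin a hu (killed0 s).
by congr killed; apply/funext => k; rewrite addr0.
Qed.

Lemma killed_add s u v : killed s u -> killed s v -> killed s (fun k => u k + v k).
Proof.
move=> hu hv; have := killed_lin 1 hu hv.
by congr killed; apply/funext => k; rewrite mul1r.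
Qed.

Lemma killed_sum s I (r : seq I) (f : I -> nat -> F) :
  (forall i, killed s (f i)) -> killed s (fun k => \sum_(i <- r) f i k).
Proof.
move=> hf; elim: r => [|i r IH].
  have -> : (fun k => \sum_(i <- [::]) f i k) = fun=> 0 by apply/funext=> k; rewrite big_nil.
  exact: killed0.
have -> : (fun k => \sum_(j <- i :: r) f j k) = fun k => f i k + \sum_(j <- r) f j k.
  by apply/funext=> k; rewrite big_cons.
exact: killed_add.
Qed.

Lemma killed_shift s n u : killed s u -> killed s (fun k => u (n + k)%N).
Proof.
elim: s u => [|mu s IH] u /= hu; first by move=> k.
by have := IH _ hu; congr killed; apply/funext => k; rewrite addnS.
Qed.

Lemma killed_catl s t u : killed s u -> killed (t ++ s) u.
Proof.
elim: t u => [|mu t IH] u hu //=; apply: IH.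
have := killed_lin (- mu) hu (killed_shift 1 hu).
by congr killed; apply/funext => k; rewrite add1n mulNr addrC.
Qed.

Lemma killed_catr s t u : killed s u -> killed (s ++ t) u.
Proof.
elim: s u => [|mu s IH] u /= hu; last exact: IH.
by have -> : u = fun=> 0; [exact/funext|exact: killed0].
Qed.

(** By induction [S - nu] already kills [w], so that [w] is geometric of ratio [nu]. Applying [C] to
    it multiplies it by [C.[nu]], which is nonzero. *)
Lemma killed_coprime s (C : {poly F}) w :
  {in s, forall nu, C.[nu] != 0} -> killed s w ->
  (forall k, \sum_(i < size C) C`_i * w (i + k)%N = 0) -> forall k, w k = 0.
Proof.
elim: s w => [|nu s IH] w //= Cs sw Cw.
have w1 k : w k.+1 = nu * w k.
  apply/eqP; rewrite -subr_eq0; apply/eqP; move: k.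
  apply: IH => // [x xs|k]; first by apply: Cs; rewrite inE xs orbT.
  transitivity (\sum_(i < size C) C`_i * w (i + k.+1)%N -
    nu * \sum_(i < size C) C`_i * w (i + k)%N); last by rewrite !Cw mulr0 subr0.
  rewrite mulr_sumr -sumrB; apply: eq_bigr => i _.
  by rewrite addnS mulrBr [nu * (_ * _)]mulrCA.
have wn k n : w (n + k)%N = nu ^+ n * w k.
  by elim: n => [|n IHn]; rewrite ?mul1r // addSn w1 IHn exprS mulrA.
move=> k; have := Cw k; under eq_bigr do rewrite wn mulrA.
rewrite -mulr_suml -horner_coef => /eqP; rewrite mulf_eq0 (negbTE (Cs _ (mem_head _ _))).
by move/eqP.
Qed.

Variable Gamma : set F.
Hypotheses (Gamma1 : Gamma 1) (Gamma0 : forall x, Gamma x -> x != 0)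
  (GammaV : forall x y, Gamma x -> Gamma y -> Gamma (x / y)).

(** The sequence [u (l + k) - mu ^+ l * u k] is killed without the factor [mu] and still vanishes at
    the multiples of [l], so it is zero by induction. It is also [C] applied to [w]; coprimality
    then gives [w = 0], so that [u] is geometric, and [u 0 = 0]. *)
Lemma killed_eq0 l s u : prime l -> (l%:R != 0 :> F) ->
  (forall z, Gamma z -> z ^+ l = 1 -> z = 1) ->
  {in s, forall mu, Gamma mu} -> killed s u -> (forall k, u (l * k)%N = 0) ->
  forall k, u k = 0.
Proof.
move=> lp l0 tors; have l_gt0 := prime_gt0 lp.
elim: s u => [|mu s IH] u //= sG su ul.
have Gmu := sG _ (mem_head _ _).
have {}sG : {in s, forall x, Gamma x} by move=> x xs; apply: sG; rewrite inE xs orbT.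
pose w k := u k.+1 - mu * u k.
(* [C = (X^l - mu^l) / (X - mu)] has no zero in [Gamma]. *)
pose C := \poly_(i < l) mu ^+ (l.-1 - i).
have sizeC : size C = l.
  apply/eqP; rewrite eqn_leq size_poly /= -{1}(prednK l_gt0).
  have Cl : C`_l.-1 != 0 by rewrite coef_poly prednK // leqnn subnn oner_neq0.
  by rewrite ltnNge; apply: contra Cl => /leq_sizeP->.
have Cw k : \sum_(i < size C) C`_i * w (i + k)%N = u (l + k)%N - mu ^+ l * u k.
  rewrite sizeC -(prednK l_gt0) -/(l.-1.+1).
  pose f i := mu ^+ (l - i) * u (i + k)%N.
  transitivity (\sum_(0 <= i < l) (f i.+1 - f i)).
    rewrite big_mkord prednK //; apply: eq_bigr => i _.
    rewrite coef_poly ltn_ord /w /f mulrBr mulrA -exprSr addSn.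
    by congr (_ * _ - _ * _); congr (mu ^+ _); have := ltn_ord i; lia.
  by rewrite telescope_sumr // /f subnn expr0 mul1r subn0 add0n prednK.
have Su k : u (l + k)%N = mu ^+ l * u k.
  apply/eqP; rewrite -subr_eq0; apply/eqP; move: k.
  apply: IH => // [|k]; last by rewrite -mulnS !ul mulr0 subrr.
  have := killed_sum (index_enum 'I_(size C)) (fun i =>
    killed_scale C`_i (killed_shift i su)).
  by congr killed; apply/funext => k; rewrite -Cw.
have w0 : forall k, w k = 0.
  apply: (killed_coprime (s := s) (C := C)) => // [nu /sG Gnu|k]; last by rewrite Cw Su subrr.
  (* At a zero [nu] of [C] the powers [nu ^+ l] and [mu ^+ l] agree, so [nu = mu] as [Gamma] has no
     [l]-torsion; but [C.[mu]] is [l * mu ^+ l.-1], which is nonzero. *)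
  have Ce : (mu - nu) * C.[nu] = mu ^+ l - nu ^+ l by rewrite subrXX horner_poly.
  apply/eqP => C0; move: Ce; rewrite C0 mulr0 => /esym/eqP; rewrite subr_eq0 => /eqP numu.
  have : nu / mu = 1.
    by apply: tors; [exact: GammaV|rewrite expr_div_n numu divff // expf_neq0 // Gamma0].
  move=> /divr1_eq numu1; move/eqP: C0; rewrite numu1 horner_poly.
  rewrite (eq_bigr (fun=> mu ^+ l.-1)) => [|i _]; last first.
    by rewrite -exprD subnK // -ltnS prednK.
  rewrite sumr_const card_ord -mulr_natl mulf_eq0 (negbTE l0) expf_eq0.
  by rewrite (negbTE (Gamma0 Gmu)) andbF.
elim=> [|k IHk]; first by rewrite -(muln0 l) ul.
by have /eqP := w0 k; rewrite /w IHk mulr0 subr0 => /eqP.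
Qed.

Definition recurrent u := exists2 s, {in s, forall mu, Gamma mu} & killed s u.

Lemma recurrent_add u v : recurrent u -> recurrent v -> recurrent (fun k => u k + v k).
Proof.
move=> [s sG hu] [t tG hv]; exists (s ++ t).
  by move=> x; rewrite mem_cat => /orP[/sG|/tG].
by apply: killed_add; [exact: killed_catr|exact: killed_catl].
Qed.

Lemma recurrent_const a : recurrent (fun=> a).
Proof.
exists [:: 1] => [x|/= k]; first by rewrite inE => /eqP->.
by rewrite mul1r subrr.
Qed.

(** A Leibniz rule: [S - mu * nu] sends [u v] to [(S - mu) u] times the shift of [v], plus [mu u]
    times [(S - nu) v]. Both terms have a shorter recurrence in one factor. *)
Lemma recurrent_mul u v : recurrent u -> recurrent v -> recurrent (fun k => u k * v k).
Proof.
have GM x y : Gamma x -> Gamma y -> Gamma (x * y).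
  by move=> Gx Gy; rewrite -[y]invrK -[y^-1]div1r; do 2?apply: GammaV.
move=> [s sG hu] [t tG hv].
have [n] := ubnP (size s + size t); elim: n => // n IH in s t u v sG tG hu hv *.
case: s sG hu => [|mu s] sG hu.
  move=> _; exists [::] => //= k; by rewrite hu mul0r.
case: t tG hv => [|nu t] tG hv.
  move=> _; exists [::] => //= k; by rewrite hv mulr0.
rewrite /= addSn addnS ltnS => le.
have sG' : {in s, forall x, Gamma x} by move=> x xs; apply: sG; rewrite inE xs orbT.
have tG' : {in t, forall x, Gamma x} by move=> x xs; apply: tG; rewrite inE xs orbT.
have h1 : recurrent (fun k => (u k.+1 - mu * u k) * v k.+1).
  by apply: (IH s (nu :: t)) => //; [exact: (killed_shift 1 hv)|rewrite /= addnS].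
have h2 : recurrent (fun k => mu * u k * (v k.+1 - nu * v k)).
  by apply: (IH (mu :: s) t) => //; exact: killed_scale.
have [r rG hr] := recurrent_add h1 h2.
exists (mu * nu :: r).
  move=> x; rewrite inE => /orP[/eqP->|/rG//].
  by apply: GM; [apply: sG|apply: tG]; rewrite mem_head.
rewrite /=; move: hr; congr killed; apply/funext => k.
by rewrite mulrBl mulrBr addrA subrK; congr (_ - _); rewrite mulrACA.
Qed.

Lemma recurrent_exp u n : recurrent u -> recurrent (fun k => u k ^+ n).
Proof.
move=> hu; elim: n => [|n IH]; first exact: recurrent_const.
have -> : (fun k => u k ^+ n.+1) = fun k => u k * u k ^+ n by apply/funext=> k; rewrite exprS.
exact: recurrent_mul.
Qed.

Lemma recurrent_sum I (r : seq I) (f : I -> nat -> F) :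
  (forall i, recurrent (f i)) -> recurrent (fun k => \sum_(i <- r) f i k).
Proof.
move=> hf; elim: r => [|i r IH].
  have -> : (fun k => \sum_(i <- [::]) f i k) = fun=> 0 by apply/funext=> k; rewrite big_nil.
  exact: recurrent_const.
have -> : (fun k => \sum_(j <- i :: r) f j k) = fun k => f i k + \sum_(j <- r) f j k.
  by apply/funext=> k; rewrite big_cons.
exact: recurrent_add.
Qed.

Lemma recurrent_prod I (r : seq I) (f : I -> nat -> F) :
  (forall i, recurrent (f i)) -> recurrent (fun k => \prod_(i <- r) f i k).
Proof.
move=> hf; elim: r => [|i r IH].
  have -> : (fun k => \prod_(i <- [::]) f i k) = fun=> 1 by apply/funext=> k; rewrite big_nil.
  exact: recurrent_const.
have -> : (fun k => \prod_(j <- i :: r) f j k) = fun k => f i k * \prod_(j <- r) f j k.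
  by apply/funext=> k; rewrite big_cons.
exact: recurrent_mul.
Qed.

Lemma recurrent_mmap (R : nzRingType) m (c : R -> F) (h : nat -> 'I_m -> F) (f : mpoly.mpoly m R) :
  (forall i, recurrent (fun k => h k i)) -> recurrent (fun k => mpoly.mmap c (h k) f).
Proof.
move=> hh; rewrite /mpoly.mmap; apply: recurrent_sum => e.
apply: recurrent_mul; first exact: recurrent_const.
by rewrite /mpoly.mmap1; apply: recurrent_prod => i; exact: recurrent_exp.
Qed.

End Recurrences.

Definition mxpow (R : pzSemiRingType) n (g : 'M[R]_n) k := iter k (mulmx^~ g) 1%:M.

Lemma mxpowE (R : nzRingType) n (g : 'M[R]_n.+1) k : mxpow g k = g ^+ k.
Proof. by elim: k => //= k ->; rewrite exprSr. Qed.

Section Eigenvalues.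
Variable F : closedFieldType.
Variable Gamma : set F.
Hypotheses (Gamma1 : Gamma 1) (Gamma0 : forall x, Gamma x -> x != 0)
  (GammaV : forall x y, Gamma x -> Gamma y -> Gamma (x / y)).

Lemma recurrent_mxpow n (g : 'M[F]_n) i j :
  (forall x, root (char_poly g) x -> Gamma x) ->
  recurrent Gamma (fun k => mxpow g k i j).
Proof.
case: n g i j => [|n] g i j; first by case: i.
move=> gG; have [s sE] := closed_field_poly_normal (char_poly g).
rewrite (monicP (char_poly_monic g)) scale1r in sE.
exists s; first by move=> x xs; apply: gG; rewrite sE root_prod_XsubC.
(* Cayley-Hamilton gives the case [A = 1]. The general [A] absorbs the factors [g - mu] that have
   already been applied to the sequence. *)
have key A : A * \prod_(mu <- s) (g - mu%:M) = 0 ->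
    killed s (fun k => (A * g ^+ k) i j).
  elim: s A {sE} => [|mu s IH] A; first by rewrite big_nil mulr1 /= => -> k; rewrite mul0r mxE.
  rewrite big_cons mulrA => /IH /=; congr killed; apply/funext => k.
  rewrite exprS !mulrA mulrBr mulrBl mxE [in X in _ + X]mxE; congr (_ - _).
  by rewrite -[A * mu%:M]/(A *m mu%:M) mul_mx_scalar -scalerAl mxE.
have -> : (fun k => mxpow g k i j) = fun k => (1 * g ^+ k) i j.
  by apply/funext => k; rewrite mxpowE mul1r.
apply: key; rewrite mul1r -(Cayley_Hamilton g) sE rmorph_prod; apply: eq_bigr => mu _.
by rewrite rmorphB /= horner_mx_X horner_mx_C.
Qed.

Lemma torsion_eigenvalue n (g : 'M[F]_n) l (c : rat -> F) (f : mpoly.mpoly (n * n) rat) :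
  prime l -> l%:R != 0 :> F -> (forall x, root (char_poly g) x -> Gamma x) ->
  (forall k, mpoly.mmap c (fun i => mxvec (mxpow g (l * k)) 0 i) f = 0) ->
  mpoly.mmap c (fun i => mxvec g 0 i) f != 0 ->
  exists z, [/\ Gamma z, z ^+ l = 1 & z != 1].
Proof.
move=> lp l0 gG fl; apply: contraNP => nz; apply/eqP.
pose u k := mpoly.mmap c (fun i => mxvec (mxpow g k) 0 i) f.
have [s sG su] : recurrent Gamma u.
  apply: recurrent_mmap => // x; case/mxvec_indexP: x => a b.
  have -> : (fun k => mxvec (mxpow g k) 0 (mxvec_index a b)) = fun k => mxpow g k a b.
    by apply/funext => k; rewrite mxvecE.
  exact: recurrent_mxpow.
have := killed_eq0 Gamma0 GammaV lp l0 _ sG su fl 1.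
rewrite /u /mxpow /= mul1mx; apply=> z Gz zl.
by apply: contrapT => /eqP z1; apply: nz; exists z.
Qed.
End Eigenvalues.

(** * The p-adic and adelic topologies *)

Lemma fracP (D : idomainType) (x : {fraction D}) :
  exists a b : D, b != 0 /\ x = tofrac a / tofrac b.
Proof.
elim/quotW: x => r; exists (frac r).1, (frac r).2; split; first exact: denom_ratioP.
have r2 : tofrac (frac r).2 != 0 by rewrite tofrac_eq0 denom_ratioP.
apply: (mulIf r2); rewrite divfK //.
unlock tofrac; rewrite -[LHS]FracField.pi_mul; apply/eqmodP; rewrite /= FracField.equivfE /FracField.mulf.
rewrite !numden_Ratio ?mulr1 ?oner_neq0 ?denom_ratioP //.
by rewrite mulrC.
Qed.

Lemma tofrac_inj (D : idomainType) : injective (@tofrac D).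
Proof. by move=> x y /eqP; rewrite tofrac_eq => /eqP. Qed.

Lemma frac_expand (F : fieldType) (a b a' b' d d' z z' e : F) :
  b != 0 -> b' != 0 -> d != 0 -> d' != 0 ->
  (a / b + e * (z / d)) * (a' / b' + e * (z' / d')) =
  a / b * (a' / b') + e * ((a * z' * (d * b') + a' * z * (d' * b) +
    e * (z * z' * (b * b'))) / (d * d' * (b * b'))).
Proof. by move=> h1 h2 h3 h4; field; rewrite h1 h2 h3 h4. Qed.

Section PadicNumbers.
Variable p : prime_t.

Lemma Zp_natE m k : (m%:R : Zp p) k = (m%:Z %% (pnat p ^ k)%N%:Z)%Z.
Proof.
elim: m => [|m IH] //.
by rewrite -natr1 /= IH modzDm -[in RHS]addn1 PoszD.
Qed.

Lemma Zp0E k : (0 : Zp p) k = 0.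
Proof. exact: mod0z. Qed.

Lemma Zp_nat_neq0 m : (0 < m)%N -> m%:R != 0 :> Zp p.
Proof.
move=> m0; apply/eqP => /(congr1 (fun x : Zp p => x m)).
rewrite Zp_natE Zp0E => /dvdz_mod0P; rewrite dvdzE /= => /(dvdn_leq m0).
by rewrite leqNgt ltn_expl // prime_gt1 // (valP p).
Qed.

Lemma pchar_Qp : [pchar Qp p] =i pred0.
Proof.
move=> l; rewrite !inE; apply/negP => /andP[lp].
have -> : l%:R = tofrac l%:R :> Qp p by rewrite rmorph_nat.
by rewrite tofrac_eq0 (negbTE (Zp_nat_neq0 (prime_gt0 lp))).
Qed.

Lemma Qp_nat_neq0 m : (0 < m)%N -> m%:R != 0 :> Qp p.
Proof. by move=> m0; rewrite -(rmorph_nat (@tofrac _)) tofrac_eq0 Zp_nat_neq0. Qed.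

Lemma Zp_not_divisible (x : Zp p) : x != 0 ->
  exists2 N : nat, (0 < N)%N & forall y, x <> N%:R * y.
Proof.
move=> x0.
have [k xk] : exists k, x k <> (0 : Zp p) k.
  by apply: contrapT => /forallNP h; move/eqP: x0; apply; apply: zp_eq => k; exact: contrapT.
exists (pnat p ^ k)%N => [|y xE]; first by rewrite expn_gt0 prime_gt0 // (valP p).
by apply: xk; rewrite xE Zp0E /= Zp_natE modzz mul0r mod0z.
Qed.

Lemma zint_nat m : @zint p m%:R.
Proof. by exists m%:R; rewrite rmorph_nat. Qed.
Lemma zintD x y : @zint p x -> zint y -> zint (x + y).
Proof. by move=> [a ->] [b ->]; exists (a + b); rewrite rmorphD. Qed.
Lemma zintM x y : @zint p x -> zint y -> zint (x * y).
Proof. by move=> [a ->] [b ->]; exists (a * b); rewrite rmorphM. Qed.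
Lemma zint0 : @zint p 0.
Proof. exact: (zint_nat 0). Qed.

Definition zint_mx n : set 'M[Qp p]_n := [set A | forall i j, zint (A i j)].

Lemma zint_mxM n (A B : 'M[Qp p]_n) : zint_mx A -> zint_mx B -> zint_mx (A *m B).
Proof.
move=> hA hB i j; rewrite mxE; elim/big_ind: _ => [||k _]; first exact: zint0.
  exact: zintD.
exact: zintM.
Qed.

Lemma zint_mxD n (A B : 'M[Qp p]_n) : zint_mx A -> zint_mx B -> zint_mx (A + B).
Proof. by move=> hA hB i j; rewrite mxE; exact: zintD. Qed.

Lemma zint_mxZ n m (A : 'M[Qp p]_n) : zint_mx A -> zint_mx (m%:R *: A).
Proof. by move=> hA i j; rewrite mxE; apply: zintM => //; exact: zint_nat. Qed.

Lemma zint_mx1 n : @zint_mx n 1%:M.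
Proof. by move=> i j; rewrite mxE; exact: zint_nat. Qed.

Lemma zint_mxE n N (A : 'M[Qp p]_n) :
  (forall i j, exists2 z, zint z & (A - 1%:M) i j = N%:R * z) <->
  exists2 Z, zint_mx Z & A = 1%:M + N%:R *: Z.
Proof.
split=> [h|[Z hZ ->] i j]; last by exists (Z i j) => //; rewrite addrC addKr mxE.
have /choice[f fP] : forall ij : 'I_n * 'I_n, exists z,
    zint z /\ (A - 1%:M) ij.1 ij.2 = N%:R * z.
  by move=> -[i j]; have [z] := h i j; exists z.
exists (\matrix_(i, j) f (i, j)); first by move=> i j; rewrite mxE; case: (fP (i, j)).
apply/matrixP => i j; have [_] := fP (i, j); rewrite !mxE /= => <-.
by rewrite addrC subrK.
Qed.

(* [d] bounds the denominators, so that [u N Z] tends to [c] when [N] tends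
   p-adically to 0. *)
Definition nearly_constant n (u : nat -> 'M[Qp p]_n -> Qp p) (c : Qp p) :=
  exists2 d : Zp p, d != 0 & forall N Z, zint_mx Z ->
    exists2 z, zint z & u N Z = c + N%:R * (z / tofrac d).

Lemma nearly_constant_cst n c : @nearly_constant n (fun _ _ => c) c.
Proof.
exists 1; rewrite ?oner_neq0 // => N Z _; exists 0; first exact: zint0.
by rewrite mul0r mulr0 addr0.
Qed.

Lemma nearly_constant_add n u v c e : @nearly_constant n u c -> nearly_constant v e ->
  nearly_constant (fun N Z => u N Z + v N Z) (c + e).
Proof.
move=> [d d0 hu] [d' d'0 hv]; exists (d * d'); rewrite ?mulf_neq0 // => N Z hZ.
have [z hz ->] := hu N Z hZ; have [z' hz' ->] := hv N Z hZ.
exists (z * tofrac d' + z' * tofrac d).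
  by apply: zintD; apply: zintM => //; [exists d'|exists d].
rewrite addrACA -mulrDr; congr (_ + _ * _).
by rewrite addf_div ?tofrac_eq0 // rmorphM.
Qed.

Lemma nearly_constant_mul n u v c e : @nearly_constant n u c -> nearly_constant v e ->
  nearly_constant (fun N Z => u N Z * v N Z) (c * e).
Proof.
move=> [d d0 hu] [d' d'0 hv].
have [a [b [b0 cE]]] := fracP c; have [a' [b' [b'0 eE]]] := fracP e.
exists (d * d' * (b * b')); rewrite ?mulf_neq0 // => N Z hZ.
have [z hz ->] := hu N Z hZ; have [z' hz' ->] := hv N Z hZ.
pose t := @tofrac (Zp p).
exists (t a * z' * t (d * b') + t a' * z * t (d' * b) + N%:R * (z * z' * t (b * b'))).
  have zt x : @zint p (t x) by exists x.
  apply: zintD; last first.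
    by apply: zintM; [exact: zint_nat|apply: zintM; [exact: zintM|exact: zt]].
  by apply: zintD; apply: zintM; [apply: zintM|exact: zt|apply: zintM|exact: zt].
rewrite cE eE frac_expand ?tofrac_eq0 //.
by rewrite /t !rmorphM.
Qed.
Lemma nearly_constant_sum n I (r : seq I) u c :
  (forall i, @nearly_constant n (u i) (c i)) ->
  nearly_constant (fun N Z => \sum_(i <- r) u i N Z) (\sum_(i <- r) c i).
Proof.
move=> hu; elim: r => [|i r IH].
  rewrite big_nil.
  have -> : (fun N Z => \sum_(i <- [::]) u i N Z) = fun _ _ => 0.
    by apply/funext => N; apply/funext => Z; rewrite big_nil.
  exact: nearly_constant_cst.
rewrite big_cons.
have -> : (fun N Z => \sum_(j <- i :: r) u j N Z) =
    fun N Z => u i N Z + \sum_(j <- r) u j N Z.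
  by apply/funext => N; apply/funext => Z; rewrite big_cons.
exact: nearly_constant_add.
Qed.

Lemma nearly_constant_prod n I (r : seq I) u c :
  (forall i, @nearly_constant n (u i) (c i)) ->
  nearly_constant (fun N Z => \prod_(i <- r) u i N Z) (\prod_(i <- r) c i).
Proof.
move=> hu; elim: r => [|i r IH].
  rewrite big_nil.
  have -> : (fun N Z => \prod_(i <- [::]) u i N Z) = fun _ _ => 1.
    by apply/funext => N; apply/funext => Z; rewrite big_nil.
  exact: nearly_constant_cst.
rewrite big_cons.
have -> : (fun N Z => \prod_(j <- i :: r) u j N Z) =
    fun N Z => u i N Z * \prod_(j <- r) u j N Z.
  by apply/funext => N; apply/funext => Z; rewrite big_cons.
exact: nearly_constant_mul.
Qed.

Lemma nearly_constant_exp n u c k : @nearly_constant n u c ->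
  nearly_constant (fun N Z => u N Z ^+ k) (c ^+ k).
Proof.
move=> hu; elim: k => [|k IH]; first by rewrite expr0; exact: nearly_constant_cst.
rewrite exprS.
have -> : (fun N Z => u N Z ^+ k.+1) = fun N Z => u N Z * u N Z ^+ k.
  by apply/funext => N; apply/funext => Z; rewrite exprS.
exact: nearly_constant_mul.
Qed.
End PadicNumbers.

Lemma invmx_mul (F : fieldType) n (A B : 'M[F]_n) :
  A \in unitmx -> B \in unitmx -> invmx (A *m B) = invmx B *m invmx A.
Proof.
move=> uA uB; have uAB : A *m B \in unitmx by rewrite unitmx_mul uA.
have e : (A *m B) *m (invmx B *m invmx A) = 1%:M by rewrite mulmxA mulmxK // mulmxV.
by rewrite -(mulKmx uAB (invmx B *m invmx A)) e mulmx1.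
Qed.

Lemma clear_denominators (F : fieldType) (a b d y e : F) : b != 0 -> d != 0 ->
  a / b + e * (y / d) = 0 -> a * d = e * - (y * b).
Proof.
move=> b0 d0 /eqP; rewrite addr_eq0 => /eqP h.
by rewrite -(divfK b0 a) h; field; rewrite d0.
Qed.

Section Closedness.
Variables (p : prime_t) (n : nat).

Lemma nearly_constant_entry (g : 'M[Qp p]_n) i j :
  nearly_constant (fun N Z => (g *m (1%:M + N%:R *: Z)) i j) (g i j).
Proof.
have h : nearly_constant (fun N Z => g i j + \sum_k g i k * (N%:R * Z k j)) (g i j + 0).
  apply: nearly_constant_add; first exact: nearly_constant_cst.
  have c0 (k : 'I_n) : nearly_constant (fun N (Z : 'M[Qp p]_n) => g i k * (N%:R * Z k j)) 0.
    have -> : 0 = g i k * 0 :> Qp p by rewrite mulr0.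
    apply: nearly_constant_mul; first exact: nearly_constant_cst.
    exists 1; rewrite ?oner_neq0 // => N Z hZ; exists (Z k j) => //.
    by rewrite add0r rmorph1 divr1.
  have := nearly_constant_sum (index_enum 'I_n) c0.
  by rewrite big1_eq.
rewrite addr0 in h; move: h; congr nearly_constant.
apply/funext => N; apply/funext => Z.
rewrite mulmxDr mulmx1 !mxE; congr (_ + _); apply: eq_bigr => k _.
by rewrite mxE.
Qed.

Lemma nearly_constant_mmap m (c : rat -> Qp p) (h : nat -> 'M[Qp p]_n -> 'I_m -> Qp p)
    h0 (f : mpoly.mpoly m rat) :
  (forall i, nearly_constant (fun N Z => h N Z i) (h0 i)) ->
  nearly_constant (fun N Z => mpoly.mmap c (h N Z) f) (mpoly.mmap c h0 f).
Proof.
move=> hh; apply: nearly_constant_sum => e.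
apply: nearly_constant_mul; first exact: nearly_constant_cst.
by apply: nearly_constant_prod => i; exact: nearly_constant_exp.
Qed.

(** The value at [g (1 + N Z)] is [a / b + N y / d], with [b] and [d] independent of [N] and [Z]. If
    it vanished, [N] would divide [a * d] in [Zp p], and [N] is chosen so that it does not. *)
Lemma qeval_near (f : qpoly n) (g : 'M[Qp p]_n) : qeval f g != 0 ->
  exists2 N, (0 < N)%N & forall Z, zint_mx Z -> qeval f (g *m (1%:M + N%:R *: Z)) != 0.
Proof.
move=> fg0.
have [d d0 near] : nearly_constant (fun N Z => qeval f (g *m (1%:M + N%:R *: Z))) (qeval f g).
  apply: nearly_constant_mmap => i; case/mxvec_indexP: i => i j; rewrite mxvecE.
  have -> : (fun N Z => mxvec (g *m (1%:M + N%:R *: Z)) 0 (mxvec_index i j)) =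
      fun N Z => (g *m (1%:M + N%:R *: Z)) i j.
    by apply/funext => N; apply/funext => Z; rewrite mxvecE.
  exact: nearly_constant_entry.
have [a [b [b0 abE]]] := fracP (qeval f g).
have a0 : a != 0 by apply: contraNneq fg0 => a0; rewrite abE a0 rmorph0 mul0r.
have [|N N0 ndiv] := @Zp_not_divisible p (a * d); first by rewrite mulf_neq0.
exists N; first exact: N0.
move=> Z hZ; have [_ [y ->] uE] := near N Z hZ.
apply/eqP; rewrite uE abE => e; apply: (ndiv (- (y * b))).
apply: (@tofrac_inj (Zp p)).
rewrite tofracM (tofracM N%:R) tofracN tofracM (rmorph_nat (@tofrac (Zp p))).
by apply: clear_denominators e; rewrite tofrac_eq0.
Qed.
End Closedness.

(** * Adelic points and their compact open subgroups *)

Section AdeleGroup.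
Variable n : nat.
Implicit Types (G H : qgroup n) (g h k : adele n).

(** [adele n] contains all families of matrices, so cancellation has to be restricted to the
    invertible ones. *)
Definition aunit : set (adele n) := [set g | forall p, g p \in unitmx].

Lemma adele_eq g h : (forall p, g p = h p) -> g = h.
Proof. exact: functional_extensionality_dep. Qed.

Lemma apts_unit G g : apts G g -> aunit g.
Proof. by move=> [Gg _] p; case: (Gg p). Qed.

Lemma amulA g h k : amul g (amul h k) = amul (amul g h) k.
Proof. by apply: adele_eq => p; rewrite /amul mulmxA. Qed.
Lemma amul1 g : amul (aone n) g = g.
Proof. by apply: adele_eq => p; rewrite /amul mul1mx. Qed.
Lemma amulr1 g : amul g (aone n) = g.
Proof. by apply: adele_eq => p; rewrite /amul mulmx1. Qed.
Lemma amulV g : aunit g -> amul (ainv g) g = aone n.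
Proof. by move=> ug; apply: adele_eq => p; rewrite /amul /ainv mulVmx. Qed.
Lemma amulrV g : aunit g -> amul g (ainv g) = aone n.
Proof. by move=> ug; apply: adele_eq => p; rewrite /amul /ainv mulmxV. Qed.
Lemma amulK g h : aunit g -> amul (ainv g) (amul g h) = h.
Proof. by move=> ug; rewrite amulA amulV // amul1. Qed.
Lemma amulrK g h : aunit g -> amul (amul h g) (ainv g) = h.
Proof. by move=> ug; rewrite -amulA amulrV // amulr1. Qed.
Lemma aunit_mul g h : aunit g -> aunit h -> aunit (amul g h).
Proof. by move=> ug uh p; rewrite /amul unitmx_mul; apply/andP; split; [exact: ug|exact: uh]. Qed.
Lemma aunit_inv g : aunit g -> aunit (ainv g).
Proof. by move=> ug p; rewrite /ainv unitmx_inv; exact: ug. Qed.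
Lemma ainvK g : ainv (ainv g) = g.
Proof. by apply: adele_eq => p; rewrite /ainv invmxK. Qed.
Lemma ainv_mul g h : aunit g -> aunit h -> ainv (amul g h) = amul (ainv h) (ainv g).
Proof. by move=> ug uh; apply: adele_eq => p; rewrite /ainv /amul invmx_mul; [|exact: ug|exact: uh]. Qed.
Lemma ainv1 : ainv (aone n) = aone n.
Proof. by apply: adele_eq => p; rewrite /ainv /aone invmx1. Qed.

Lemma qpts_Qp G p : is_subgroup (qpts G (Qp p)).
Proof. exact/qgroupP/pchar_Qp. Qed.

Lemma apts_one G : apts G (aone n).
Proof.
split=> [p|]; first by case: (qpts_Qp G p).
by exists 0%N => p _ i j; rewrite /aone invmx1; split; exact: zint_mx1.
Qed.

Lemma apts_mul G g h : apts G g -> apts G h -> apts G (amul g h).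
Proof.
move=> Gg Gh; have [ug uh] := (apts_unit Gg, apts_unit Gh).
move: Gg Gh => [Gg [B gB]] [Gh [B' hB']]; split=> [p|].
  by case: (qpts_Qp G p) => _ _ GM _; exact: GM.
exists (maxn B B') => p; rewrite gtn_max => /andP[Bp B'p] i j.
rewrite /amul invmx_mul; [|exact: ug|exact: uh]; split; apply: zint_mxM => k l.
- by case: (gB p Bp k l).
- by case: (hB' p B'p k l).
- by case: (hB' p B'p k l).
- by case: (gB p Bp k l).
Qed.

Lemma apts_inv G g : apts G g -> apts G (ainv g).
Proof.
move=> [Gg [B gB]]; split=> [p|].
  by case: (qpts_Qp G p) => _ _ _ GV; exact: GV.
by exists B => p Bp i j; rewrite /ainv invmxK; case: (gB p Bp i j).
Qed.

Lemma apts_sub G H g : qsub H G -> apts H g -> apts G g.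
Proof. by move=> HG [Hg Bg]; split=> // p; apply: HG; [exact: pchar_Qp|exact: Hg]. Qed.

Lemma apts_points G H g : apts G g -> (forall p, qpts H (Qp p) (g p)) -> apts H g.
Proof. by move=> [_ Bg] Hg; split. Qed.

Lemma acongrP N g : acongr N g <->
  (forall p, exists2 Z, zint_mx Z & g p = 1%:M + N%:R *: Z) /\
  (forall p, exists2 Z, zint_mx Z & ainv g p = 1%:M + N%:R *: Z).
Proof.
split=> [h|[h h'] p i j].
  by split=> p; apply/zint_mxE => i j; case: (h p i j).
by split; [have /zint_mxE := h p|have /zint_mxE := h' p]; exact.
Qed.

Lemma acongr_one N : acongr N (aone n).
Proof.
have h p : exists2 Z, zint_mx Z & aone n p = 1%:M + N%:R *: Z.
  by exists 0 => [i j|]; rewrite ?mxE ?scaler0 ?addr0 //; exact: zint0.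
by apply/acongrP; rewrite ainv1.
Qed.

Lemma acongr_inv N g : acongr N g -> acongr N (ainv g).
Proof. by move=> /acongrP[h h']; apply/acongrP; rewrite ainvK. Qed.

Lemma congr1_mul p N (A B : 'M[Qp p]_n) :
  (exists2 Z, zint_mx Z & A = 1%:M + N%:R *: Z) ->
  (exists2 Z, zint_mx Z & B = 1%:M + N%:R *: Z) ->
  exists2 Z, zint_mx Z & A *m B = 1%:M + N%:R *: Z.
Proof.
move=> [Z hZ ->] [W hW ->]; exists (Z + W + N%:R *: (Z *m W)).
  by apply: zint_mxD; [exact: zint_mxD|apply: zint_mxZ; exact: zint_mxM].
rewrite mulmxDl mulmxDr mulmx1 mul1mx mulmxDr mulmx1 -scalemxAl -scalemxAr.
by rewrite !scalerDr -!addrA; congr (_ + _); rewrite addrCA.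
Qed.

Lemma acongr_mul N g h : aunit g -> aunit h -> acongr N g -> acongr N h ->
  acongr N (amul g h).
Proof.
move=> ug uh /acongrP[hg hg'] /acongrP[hh hh']; apply/acongrP.
rewrite (ainv_mul ug uh); split=> p.
  by apply: congr1_mul; [exact: hg|exact: hh].
by apply: congr1_mul; [exact: hh'|exact: hg'].
Qed.

Lemma acongr_mull N N' g : acongr (N * N') g -> acongr N g.
Proof.
have key p (A : 'M[Qp p]_n) : (exists2 Z, zint_mx Z & A = 1%:M + (N * N')%:R *: Z) ->
    exists2 Z, zint_mx Z & A = 1%:M + N%:R *: Z.
  move=> [Z hZ ->]; exists (N'%:R *: Z); first exact: zint_mxZ.
  by rewrite natrM scalerA.
by move=> /acongrP[h h']; apply/acongrP; split=> p; apply: key; [exact: h|exact: h'].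
Qed.

(** An equation of [H] that fails at one component still fails near it, so [H(A_f)] is closed in
    [G(A_f)]. *)
Lemma apts_closed G H g : apts G g -> ~ apts H g ->
  exists2 N, (0 < N)%N & forall h, acongr N h -> ~ apts H (amul g h).
Proof.
move=> Gg nHg; have ug := apts_unit Gg.
have [p nHp] : exists p, ~ qpts H (Qp p) (g p).
  by apply/existsNP => Hg; apply: nHg; exact: apts_points Gg Hg.
have [f [Hf fg]] : exists f, qeqs H f /\ qeval f (g p) != 0.
  apply: contrapT => nf; apply: nHp; split=> [|f Hf]; first exact: ug.
  by apply: contrapT => /eqP fg; apply: nf; exists f.
have [N N0 hN] := qeval_near fg.
exists N; first exact: N0.
move=> h /acongrP[/(_ p)[Z hZ hE] _] [/(_ p)[_ /(_ f Hf) ghf] _].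
by have := hN Z hZ; rewrite -hE ghf eqxx.
Qed.

Lemma closed_open_compact G K C : acompact G K -> C `<=` K ->
  aopen G (K `\` C) -> acompact G C.
Proof.
move=> cK CK oKC W Wo CW.
have [||W' [W'W fW' KW']] := cK (W `|` [set K `\` C]).
- by move=> U [/Wo|->].
- move=> x Kx; have [Cx|nCx] := pselect (C x).
    by have [U WU Ux] := CW x Cx; exists U; [left|].
  by exists (K `\` C); [right|split].
exists (W' `&` W); split=> [U [_ WU]||x Cx]; first exact: WU.
  by apply: sub_finite_set fW'; exact: subIsetl.
have [U W'U Ux] := KW' x (CK x Cx).
have [WU|UE] := W'W U W'U; first by exists U; [split|].
by move: Ux; rewrite UE => -[].
Qed.

(** The topology of [H(A_f)] is induced by that of [G(A_f)]. An open set of [H(A_f)] is a union of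
    translates of congruence subgroups of [H]; [V] is the union of the same translates of those of
    [G]. *)
Lemma aopen_extend G H U : qsub H G -> aopen H U ->
  exists2 V, aopen G V & V `&` apts H = U.
Proof.
move=> HG [UH Uo].
exists [set x | apts G x /\ exists u N, [/\ U u, (0 < N)%N,
    forall h, apts H h -> acongr N h -> U (amul u h) & acongr N (amul (ainv u) x)]].
  split=> [x [Gx _]|x [Gx [u [N [Uu N0 uN ux]]]]]; first exact: Gx.
  exists N; first exact: N0.
  move=> h Gh hN; split; first exact: apts_mul.
  exists u, N; split; [exact: Uu|exact: N0|exact: uN|rewrite amulA].
  apply: acongr_mul ux hN; last exact: apts_unit Gh.
  by apply: aunit_mul; [exact/aunit_inv/(apts_unit (UH _ Uu))|exact: apts_unit Gx].
apply/seteqP; split=> [x [[Gx [u [N [Uu N0 uN ux]]]] Hx]|x Ux].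
  have Hu := UH _ Uu.
  rewrite -(amulK x (aunit_inv (apts_unit Hu))) ainvK.
  by apply: uN ux; apply: apts_mul Hx; exact: apts_inv.
have Hx := UH _ Ux; split; last exact: Hx.
split; first exact: apts_sub HG Hx.
have [N N0 xN] := Uo x Ux; exists x, N; split; [exact: Ux|exact: N0|exact: xN|].
by rewrite amulV; [exact: acongr_one|exact: apts_unit Hx].
Qed.

Lemma acompact_sub G H C : qsub H G -> C `<=` apts H -> acompact G C -> acompact H C.
Proof.
move=> HG CH cC W Wo CW.
have /choice[ext extP] : forall U, exists V, W U -> aopen G V /\ V `&` apts H = U.
  move=> U; have [WU|nWU] := pselect (W U); last by exists U.
  by have [V Vo VU] := aopen_extend HG (Wo U WU); exists V.
have [||W' [W'W fW' CW']] := cC (ext @` W).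
- by move=> _ [U WU <-]; case: (extP U WU).
- move=> x Cx; have [U WU Ux] := CW x Cx; exists (ext U); first by exists U.
  by have [_ e] := extP U WU; move: Ux; rewrite -{1}e => -[].
exists ((fun V => V `&` apts H) @` W'); split.
- by move=> _ [V W'V <-]; have [U WU <-] := W'W V W'V; have [_ ->] := extP U WU.
- exact: finite_image.
- move=> x Cx; have [V W'V Vx] := CW' x Cx.
  by exists (V `&` apts H); [exists V|split; [exact: Vx|exact: CH]].
Qed.

Section Levels.
Variables (R : realType) (cl : forall p, padic_closure R p).

Lemma neat_level_sub G H K K1 N : qsub H G -> neat_level cl G K -> (0 < N)%N ->
  K1 `<=` K -> K1 (aone n) -> (forall g h, K1 g -> K1 h -> K1 (amul g h)) ->
  (forall g, K1 g -> K1 (ainv g)) -> (forall g, K g -> acongr N g -> K1 g) ->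
  neat_level cl H (K1 `&` apts H).
Proof.
move=> HG [[[KG Ko] cK K_1 KM KV] Kneat] N0 K1K K1_1 K1M K1V NK1.
have Ku g : K g -> aunit g by move=> /KG; exact: apts_unit.
split; last by move=> k [/K1K/Kneat].
split.
- split=> [g []//|g [K1g Hg]].
  have [Ng Ng0 hNg] := Ko g (K1K g K1g).
  exists (N * Ng)%N; first by rewrite muln_gt0 N0.
  move=> h Hh hN; have Gh := apts_sub HG Hh.
  have Kgh : K (amul g h) by apply: hNg => //; apply: (@acongr_mull Ng N); rewrite mulnC.
  split; last exact: apts_mul.
  apply: K1M => //; apply: NK1; last exact: acongr_mull hN.
  by rewrite -(amulK h (Ku _ (K1K _ K1g))); apply: KM => //; exact/KV/K1K.
- apply: (acompact_sub HG); first by move=> x [].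
  apply: (closed_open_compact cK); first by move=> x [/K1K].
  split=> [g [/KG]//|g [Kg nK1Hg]].
  have [Ng Ng0 hNg] := Ko g Kg.
  have KNh h m : apts G h -> acongr (Ng * m) h -> K (amul g h) /\ K h.
    move=> Gh hN; have Kgh : K (amul g h) by apply: hNg => //; exact: acongr_mull hN.
    by split=> //; rewrite -(amulK h (Ku _ Kg)); apply: KM => //; exact/KV.
  (* The complement in [K] is open for one of two reasons: inside [H(A_f)] because the complement of
     the open subgroup [K1] is a union of its cosets, outside because [H(A_f)] is closed. *)
  have [Hg|nHg] := pselect (apts H g).
    have nK1g : ~ K1 g by move=> K1g; exact: nK1Hg.
    exists (Ng * N)%N; first by rewrite muln_gt0 Ng0.
    move=> h Gh hN; have [Kgh Kh] := KNh h N Gh hN.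
    split=> [|[K1gh _]]; first exact: Kgh.
    apply: nK1g; rewrite -(amulrK g (Ku _ Kh)); apply: (K1M _ _ K1gh); apply: K1V.
    by apply: (NK1 _ Kh); apply: (@acongr_mull N Ng); rewrite mulnC.
  have [N' N'0 hN'] := apts_closed (KG _ Kg) nHg.
  exists (Ng * N')%N; first by rewrite muln_gt0 Ng0.
  move=> h Gh hN; have [Kgh Kh] := KNh h N' Gh hN.
  split=> [|[_]]; first exact: Kgh.
  by apply: hN'; apply: (@acongr_mull N' Ng); rewrite mulnC.
- by split; [exact: K1_1|exact: apts_one].
- by move=> g h [K1g Hg] [K1h Hh]; split; [exact: K1M|exact: apts_mul].
- by move=> g [K1g Hg]; split; [exact: K1V|exact: apts_inv].
Qed.

Lemma qsub_refl G : qsub G G. Proof. by move=> F _ g. Qed.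

Definition congr_level (K : set (adele n)) N := K `&` acongr N.

Lemma neat_level_congr G H K N : qsub H G -> neat_level cl G K -> (0 < N)%N ->
  neat_level cl H (congr_level K N `&` apts H).
Proof.
move=> HG hK N0; have [[[KG _] _ K_1 KM KV] _] := hK.
have Ku g : K g -> aunit g by move=> /KG; exact: apts_unit.
apply: (neat_level_sub HG hK N0) => [g [Kg _]||g h [Kg Ng] [Kh Nh]|g [Kg Ng]|g Kg Ng].
- exact: Kg.
- by split; [exact: K_1|exact: acongr_one].
- by split; [exact: KM|apply: (acongr_mul _ _ Ng Nh); exact: Ku].
- by split; [exact: KV|exact: acongr_inv].
- by split.
Qed.

Lemma neat_level_trace G H K : qsub H G -> neat_level cl G K ->
  neat_level cl H (K `&` apts H).
Proof.
move=> HG hK; have [[_ _ K_1 KM KV] _] := hK.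
by apply: (neat_level_sub HG hK (ltn0Sn 0)) KM KV _ => //.
Qed.
End Levels.
End AdeleGroup.

(** * Galois conjugates of points of Shimura varieties *)

Section RationalMorphism.
Variable F : fieldType.
Hypothesis char0 : [pchar F] =i pred0.

Lemma pchar0_intr_neq0 (d : int) : d != 0 -> d%:~R != 0 :> F.
Proof.
have nat0 m : (0 < m)%N -> m%:R != 0 :> F.
  by move=> m0; have /pcharf0P-> := char0; rewrite -lt0n.
case: d => m; first by rewrite -pmulrn => m0; apply: nat0; rewrite lt0n.
by move=> _; rewrite NegzE mulrNz oppr_eq0; exact: nat0.
Qed.

Lemma ratr_frac (m d : int) : d != 0 -> ratr (m%:~R / d%:~R) = m%:~R / d%:~R :> F.
Proof.
move=> d0; set x := m%:~R / d%:~R; rewrite /ratr.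
have e : numq x * d = m * denq x.
  apply: (@intr_inj rat); rewrite !rmorphM /=.
  have -> : (numq x)%:~R = x * (denq x)%:~R by rewrite -{2}(divq_num_den x) divfK // intr_eq0 denq_neq0.
  by rewrite mulrAC /x divfK // intr_eq0.
have [dF qF] := (pchar0_intr_neq0 d0, pchar0_intr_neq0 (denq_neq0 x)).
apply: (mulIf qF); rewrite divfK //; apply: (mulIf dF).
by rewrite mulrAC divfK // -!intrM e.
Qed.

(** Rational matrices have to be embedded in the groups over [Qp p]; the argument uses nothing of
    the field but characteristic 0. *)
Lemma rat_morphism : exists f : {rmorphism rat -> F}, f =1 ratr.
Proof.
have den0 (x : rat) : (denq x)%:~R != 0 :> rat by rewrite intr_eq0 denq_neq0.
have den0F (x : rat) := pchar0_intr_neq0 (denq_neq0 x).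
have sub (F' : fieldType) (a b c d : F') : b != 0 -> d != 0 ->
    a / b - c / d = (a * d - c * b) / (b * d).
  by move=> b0 d0; rewrite -mulNr addf_div // mulNr.
have fB : zmod_morphism (@ratr F).
  move=> x y; rewrite -{1}(divq_num_den x) -{1}(divq_num_den y).
  rewrite sub // -!intrM -intrB ratr_frac ?mulf_neq0 ?denq_neq0 //.
  by rewrite [in RHS]/ratr sub // intrB !intrM.
have fM : monoid_morphism (@ratr F).
  split=> [|x y]; first by have := @ratr_frac 1 1 (oner_neq0 _); rewrite !divr1.
  rewrite -{1}(divq_num_den x) -{1}(divq_num_den y) mulf_div -!intrM.
  by rewrite ratr_frac ?mulf_neq0 ?denq_neq0 // !intrM -mulf_div.
pose fZ := GRing.isZmodMorphism.Build rat F ratr fB.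
pose fR := GRing.isMonoidMorphism.Build rat F ratr fM.
pose g : {rmorphism rat -> F} := HB.pack (@ratr F) fZ fR.
by exists g.
Qed.
End RationalMorphism.

Lemma fmorph_ratr (F E : fieldType) (f : {rmorphism F -> E}) r : f (ratr r) = ratr r.
Proof. by rewrite /ratr fmorph_div !rmorph_int. Qed.

Lemma qeval_map (F E : fieldType) (f : {rmorphism F -> E}) n (P : qpoly n) (A : 'M[F]_n) :
  qeval P (map_mx f A) = f (qeval P A).
Proof.
rewrite /qeval /mpoly.mmap rmorph_sum; apply: eq_bigr => e _.
rewrite rmorphM fmorph_ratr; congr (_ * _).
rewrite /mpoly.mmap1 rmorph_prod; apply: eq_bigr => i _.
by rewrite -map_mxvec mxE rmorphXn.
Qed.

Lemma qpts_map (F E : fieldType) (f : {rmorphism F -> E}) n (G : qgroup n) (A : 'M[F]_n) :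
  qpts G E (map_mx f A) <-> qpts G F A.
Proof.
split=> -[uA GA]; split.
- by rewrite map_unitmx in uA.
- move=> P GP; have := GA P GP; rewrite qeval_map => /eqP.
  by rewrite fmorph_eq0 => /eqP.
- by rewrite map_unitmx.
- by move=> P GP; rewrite qeval_map GA // rmorph0.
Qed.

Lemma qpts_rat (F : fieldType) n (G : qgroup n) (A : 'M[rat]_n) : [pchar F] =i pred0 ->
  qpts G F (map_mx ratr A) <-> qpts G rat A.
Proof.
move=> /rat_morphism[f fE].
have -> : map_mx ratr A = map_mx f A :> 'M[F]_n by apply/matrixP => i j; rewrite !mxE fE.
exact: qpts_map.
Qed.

(** The inclusion of [M] in [G], in the form that [cm_functor] takes. *)
Definition qmap_id n : qmap n n :=
  QMap (fun i j => mpoly.mpolyX rat (mpoly.mnm1 (mxvec_index i j))) 0.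

Lemma qapp_id (F : fieldType) n (g : 'M[F]_n) : qapp (qmap_id n) g = g.
Proof.
apply/matrixP => i j; rewrite mxE /= expr0 divr1 /qeval /mpoly.mmap.
rewrite mpoly.msuppX big_seq1 mpoly.mcoeffX eqxx.
have -> : ratr (GRing.natmul 1 true) = 1 :> F by rewrite /ratr divr1.
by rewrite mul1r mpoly.mmap1U mxvecE.
Qed.

Section Adelic.
Variable n : nat.

Lemma arat_mul (q q' : 'M[rat]_n) : arat (q *m q') = amul (arat q) (arat q').
Proof.
apply: adele_eq => p; rewrite /arat /amul.
have [f fE] := rat_morphism (@pchar_Qp p).
have e A : map_mx ratr A = map_mx f A :> 'M[Qp p]_n by apply/matrixP => i j; rewrite !mxE fE.
by rewrite !e map_mxM.
Qed.

Lemma arat_inv (q : 'M[rat]_n) : arat (invmx q) = ainv (arat q).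
Proof.
apply: adele_eq => p; rewrite /arat /ainv.
have [f fE] := rat_morphism (@pchar_Qp p).
have e A : map_mx ratr A = map_mx f A :> 'M[Qp p]_n by apply/matrixP => i j; rewrite !mxE fE.
by rewrite !e map_invmx.
Qed.

Lemma arat_unit (q : 'M[rat]_n) : q \in unitmx -> aunit (arat q).
Proof.
move=> uq p; rewrite /arat.
have [f fE] := rat_morphism (@pchar_Qp p).
have e A : map_mx ratr A = map_mx f A :> 'M[Qp p]_n by apply/matrixP => i j; rewrite !mxE fE.
by rewrite e map_unitmx.
Qed.

Lemma arat1 : arat 1%:M = aone n.
Proof.
apply: adele_eq => p; rewrite /arat /aone.
have [f fE] := rat_morphism (@pchar_Qp p).
have e A : map_mx ratr A = map_mx f A :> 'M[Qp p]_n by apply/matrixP => i j; rewrite !mxE fE.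
by rewrite e map_mx1.
Qed.
End Adelic.

Section Proportionality.
Variable R : realType.
Local Notation C := R[i].

Lemma proportional_refl m (v : 'rV[C]_m) : proportional v v.
Proof. by exists 1; rewrite ?oner_neq0 ?scale1r. Qed.

Lemma proportional_sym m (v w : 'rV[C]_m) : proportional v w -> proportional w v.
Proof.
move=> [c c0 ->]; exists c^-1; rewrite ?invr_eq0 //.
by rewrite scalerA mulVf // scale1r.
Qed.

Lemma proportional_trans m (v w u : 'rV[C]_m) :
  proportional v w -> proportional w u -> proportional v u.
Proof.
move=> [c c0 ->] [d d0 ->]; exists (d * c); first by rewrite mulf_neq0.
by rewrite scalerA.
Qed.

Lemma proportional_map m (v w : 'rV[C]_m) (tau : {rmorphism C -> C}) :
  proportional v w -> proportional (map_mx tau v) (map_mx tau w).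
Proof. by move=> [c c0 ->]; exists (tau c); rewrite ?fmorph_eq0 // map_mxZ. Qed.

Lemma ceval_fixed m (f : mpoly.mpoly m C) (v : 'rV[C]_m) (tau : {rmorphism C -> C}) :
  (forall e, e \in mpoly.msupp f -> tau (mpoly.mcoeff e f) = mpoly.mcoeff e f) ->
  ceval f (map_mx tau v) = tau (ceval f v).
Proof.
move=> fixf; rewrite /ceval /mpoly.mmap rmorph_sum big_seq [RHS]big_seq.
apply: eq_bigr => e /fixf fe; rewrite rmorphM fe; congr (_ * _).
rewrite /mpoly.mmap1 rmorph_prod; apply: eq_bigr => i _.
by rewrite rmorphXn mxE.
Qed.

Lemma qp_mem_map (F : set C) (V : qproj R) v (tau : {rmorphism C -> C}) :
  qp_over F V -> (forall z, F z -> tau z = z) -> @qp_mem R V v -> @qp_mem R V (map_mx tau v).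
Proof.
move=> VF tF [v0 veq [f fneq fv]].
have fixf g : qp_eqs (q:=V) g \/ qp_neqs (q:=V) g -> ceval g (map_mx tau v) = tau (ceval g v).
  by move=> /VF[d gd]; apply: ceval_fixed => e /gd[_ /tF].
split.
- by rewrite map_mx_eq0.
- by move=> g geq; rewrite fixf ?veq ?rmorph0 //; left.
- by exists f => //; rewrite fixf ?fmorph_eq0 //; right.
Qed.

(** The forms that represent the morphism near [v] have coefficients fixed by [tau]. They take the
    conjugate, nonzero, value at the conjugate of [v], so they represent the morphism there as
    well. *)
Lemma regular_transport (F : set C) (V W : qproj R) Phi (tau : {rmorphism C -> C}) v w w' :
  @regular_over R F V W Phi -> qp_over F V -> (forall z, F z -> tau z = z) ->
  @qp_mem R V v -> Phi v w -> Phi (map_mx tau v) w' -> proportional w' (map_mx tau w).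
Proof.
move=> reg VF tF Vv vw vw'; have [d [f [fF fv fP]]] := reg v Vv.
have tf : \row_j ceval (f j) (map_mx tau v) = map_mx tau (\row_j ceval (f j) v).
  apply/rowP => j; rewrite !mxE ceval_fixed // => e ef.
  by have [_ /tF] := fF j e ef.
have fv' : \row_j ceval (f j) (map_mx tau v) != 0.
  by rewrite tf map_mx_eq0.
have h1 := fP _ _ Vv fv vw.
have h2 := fP _ _ (qp_mem_map VF tF Vv) fv' vw'.
apply: proportional_trans h2 _; rewrite tf; apply/proportional_sym/proportional_map.
exact: h1.
Qed.
End Proportionality.

Section Conjugation.
Variables (R : realType) (n : nat).
Implicit Types (g h : 'M[R]_n) (s : dhom R n).

Lemma conj_dhom_mul g h s : g \in unitmx -> h \in unitmx ->
  conj_dhom g (conj_dhom h s) = conj_dhom (g *m h) s.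
Proof.
move=> ug uh; apply: functional_extensionality_dep => z.
by rewrite /conj_dhom invmx_mul // !mulmxA.
Qed.

Lemma conj_dhom1 s : conj_dhom 1%:M s = s.
Proof.
by apply: functional_extensionality_dep => z; rewrite /conj_dhom invmx1 mul1mx mulmx1.
Qed.

Lemma conj_dhomK g s : g \in unitmx -> conj_dhom (invmx g) (conj_dhom g s) = s.
Proof. by move=> ug; rewrite conj_dhom_mul ?unitmx_inv // mulVmx // conj_dhom1. Qed.

Definition conj_rat (q : 'M[rat]_n) s := conj_dhom (map_mx ratr q) s.

Lemma conj_rat_mul q q' s : q \in unitmx -> q' \in unitmx ->
  conj_rat q (conj_rat q' s) = conj_rat (q *m q') s.
Proof. by move=> uq uq'; rewrite /conj_rat conj_dhom_mul ?map_unitmx // map_mxM. Qed.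

Lemma conj_ratK q s : q \in unitmx -> conj_rat (invmx q) (conj_rat q s) = s.
Proof. by move=> uq; rewrite /conj_rat map_invmx conj_dhomK // map_unitmx. Qed.

Lemma conj_class_self (G : qgroup n) s : conj_class G s s.
Proof.
exists 1%:M; last by rewrite conj_dhom1.
by have [] := qgroupP G (pchar_num R).
Qed.

Lemma conj_class_sub (G M : qgroup n) s t : qsub M G -> conj_class G t s ->
  conj_class M s `<=` conj_class G t.
Proof.
move=> MG [g Gg ->] _ [m Mm ->].
have Gm := MG _ (pchar_num R) _ Mm.
have [_ _ GM _] := qgroupP G (pchar_num R).
have [[ug _] [um _]] := (Gg, Gm).
by exists (m *m g); [exact: GM|rewrite conj_dhom_mul].
Qed.
End Conjugation.

Lemma qgroup_mul n (G : qgroup n) (F : fieldType) (g h : 'M[F]_n) : [pchar F] =i pred0 ->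
  qpts G F g -> qpts G F h -> qpts G F (g *m h).
Proof. by move=> /(qgroupP G)[_ _ GM _]; exact: GM. Qed.

Lemma qgroup_inv n (G : qgroup n) (F : fieldType) (g : 'M[F]_n) : [pchar F] =i pred0 ->
  qpts G F g -> qpts G F (invmx g).
Proof. by move=> /(qgroupP G)[_ _ _ GV]; exact: GV. Qed.

Section Transport.
Variables (R : realType) (cl : forall p : prime_t, padic_closure R p)
  (Sh : canonical_models cl)
  (n : nat) (G : qgroup n) (X : set (dhom R n)) (K : set (adele n))
  (hG : shimura_datum G X) (hK : neat_level cl G K)
  (s : dhom R n) (hs : X s) (M : qgroup n) (MG : qsub M G)
  (hMX : shimura_datum M (conj_class M s)).
Local Notation C := R[i].
Local Notation Y := (conj_class M s).
Local Notation ptM := (cm_pt Sh M Y).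
Local Notation ptG := (cm_pt Sh G X).
Local Notation one := (aone n).

Lemma class_sub : Y `<=` X.
Proof.
have [_ [t _ XE] _ _] := hG.
rewrite XE; apply: (conj_class_sub MG).
by move: hs; rewrite XE.
Qed.

(** [app_dhom] has value 0 at 0 by convention, so it is the identity on [t] only if [t] obeys the
    same convention. *)
Lemma datum_at0 t : Y t -> t 0 = 0.
Proof.
move=> /class_sub; have [_ [u [u0 _ _ _] XE] _ _] := hG; rewrite XE.
by move=> [g _ ->]; rewrite /conj_dhom u0 mulmx0 mul0mx.
Qed.

Lemma app_dhom_id t : Y t -> app_dhom (qmap_id n) t = t.
Proof.
move=> Yt; apply: functional_extensionality_dep => z; rewrite /app_dhom.
by case: eqVneq => [->|_]; rewrite ?qapp_id ?datum_at0.
Qed.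

Lemma aapp_id (g : adele n) : aapp (qmap_id n) g = g.
Proof. by apply: adele_eq => p; rewrite /aapp qapp_id. Qed.

Variable tau : {rmorphism C -> C}.
Hypothesis tau_reflexM : forall z, reflex M Y z -> tau z = z.
Hypothesis tau_fix : forall z, compositum (reflex M Y) (reflex G X) z -> tau z = z.

Lemma transport_exists K' : neat_level cl M K' ->
  exists s1 m1, [/\ Y s1, apts M m1 &
    proportional (ptM K' s1 m1) (map_mx tau (ptM K' s one))].
Proof.
move=> hK'; apply: (cm_surj hMX hK').
have Ys := conj_class_self M s.
have mem := cm_mem Sh hMX hK' Ys (apts_one M).
exact: (qp_mem_map (cm_over (c:=Sh) hMX hK') tau_reflexM mem).
Qed.

Lemma transport_image K' K1 s1 m1 : neat_level cl M K' -> neat_level cl G K1 ->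
  K' `<=` K1 -> Y s1 -> apts M m1 ->
  proportional (ptM K' s1 m1) (map_mx tau (ptM K' s one)) ->
  proportional (ptG K1 s1 m1) (map_mx tau (ptG K1 s one)).
Proof.
move=> hK' hK1 K'K1 Ys1 Mm1 e.
have hom : qhom M G (qmap_id n).
  move=> F F0; split=> [g Mg|g h _ _]; rewrite !qapp_id //; exact: MG Mg.
have YX t : Y t -> X (app_dhom (qmap_id n) t).
  by move=> Yt; rewrite app_dhom_id //; exact: class_sub.
have levels k : K' k -> K1 (aapp (qmap_id n) k) by rewrite aapp_id; exact: K'K1.
have reg := cm_functor (c:=Sh) hMX hG hK' hK1 hom YX levels.
have Ys := conj_class_self M s.
have over : qp_over (compositum (reflex M Y) (reflex G X)) (cm_var Sh M Y K').
  move=> f /(cm_over (c:=Sh) hMX hK')[d fd]; exists d => e' /fd[ed fe]; split=> //.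
  by move=> A _ + _; exact.
have mem := cm_mem Sh hMX hK' Ys (apts_one M).
apply: (regular_transport reg over tau_fix mem).
  exists s, one; rewrite (app_dhom_id Ys) aapp_id.
  by split; [exact: Ys|exact: apts_one|exact: proportional_refl|exact: proportional_refl].
exists s1, m1; rewrite (app_dhom_id Ys1) aapp_id.
by split; [exact: Ys1|exact: Mm1|exact: e|exact: proportional_refl].
Qed.

Lemma transport_level K' K1 s1 m1 : neat_level cl M K' -> neat_level cl M K1 ->
  K' `<=` K1 -> Y s1 -> apts M m1 ->
  proportional (ptM K' s1 m1) (map_mx tau (ptM K' s one)) ->
  proportional (ptM K1 s1 m1) (map_mx tau (ptM K1 s one)).
Proof.
move=> hK' hK1 K'K1 Ys1 Mm1 e.
have levels k : K' k -> K1 (amul (ainv one) (amul k one)).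
  by rewrite ainv1 amul1 amulr1; exact: K'K1.
(* The Hecke morphism attached to 1 is the projection between the levels. *)
have reg := cm_hecke (c:=Sh) hMX hK1 hK' (apts_one M) levels.
have Ys := conj_class_self M s.
have mem := cm_mem Sh hMX hK' Ys (apts_one M).
apply: (regular_transport reg (cm_over (c:=Sh) hMX hK') tau_reflexM mem).
  exists s, one; rewrite amulr1.
  by split; [exact: Ys|exact: apts_one|exact: proportional_refl|exact: proportional_refl].
exists s1, m1; rewrite amulr1.
by split; [exact: Ys1|exact: Mm1|exact: e|exact: proportional_refl].
Qed.
End Transport.

(** * The coset of the Galois image modulo M(A_f) *)

Section Representation.
Variables (R : realType) (cl : forall p : prime_t, padic_closure R p)
  (Sh : canonical_models cl)
  (n : nat) (G : qgroup n) (X : set (dhom R n)) (K : set (adele n))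
  (hG : shimura_datum G X) (hK : neat_level cl G K)
  (s : dhom R n) (hs : X s) (M : qgroup n) (MG : qsub M G)
  (hMX : shimura_datum M (conj_class M s))
  (hfib : simply_transitive G X K s).
Local Notation C := R[i].
Local Notation Y := (conj_class M s).
Local Notation ptM := (cm_pt Sh M Y).
Local Notation ptG := (cm_pt Sh G X).
Local Notation one := (aone n).
Local Notation KM := (K `&` apts M).

Lemma level_apts g : K g -> apts G g.
Proof. by have [[[KG _] _ _ _ _] _] := hK; exact: KG. Qed.
Lemma level_unit g : K g -> aunit g.
Proof. by move=> /level_apts; exact: apts_unit. Qed.
Lemma level_one : K one.
Proof. by have [[_ _ ? _ _] _] := hK. Qed.
Lemma level_mul g h : K g -> K h -> K (amul g h).
Proof. by have [[_ _ _ KM _] _] := hK; exact: KM. Qed.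
Lemma level_inv g : K g -> K (ainv g).
Proof. by have [[_ _ _ _ KV] _] := hK; exact: KV. Qed.

(** As [q] fixes [s], the elements 1 and [q^-1] of [K] act in the same way on [s, 1] in the
    projective limit; simple transitivity identifies them. *)
Lemma stabilizer_trivial q : qpts G rat q -> conj_rat q s = s -> K (arat q) ->
  arat q = one.
Proof.
move=> Gq qs Kq; have uq : q \in unitmx by case: Gq.
have G1 : qpts G rat 1%:M by have [] := qgroupP G (pchar_num rat).
have c1 : conj_dhom (map_mx ratr 1%:M) s = s by rewrite map_mx1 conj_dhom1.
have same1 : same_class G K s one s one.
  exists 1%:M, one; split; [exact: G1|exact: level_one|by []|].
  by rewrite arat1 !amul1.
have [k [_ kuniq]] := hfib hs (apts_one G) hs (apts_one G) same1 same1.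
have k1 : k = one.
  apply: kuniq; split; first exact: level_one.
  exists 1%:M, one; split; [exact: G1|by []|by []|].
  by rewrite arat1 !amul1.
have kq : k = ainv (arat q).
  apply: kuniq; split; first exact: level_inv.
  exists q, one; split; [exact: Gq|by []|exact/esym/qs|].
  by rewrite amulr1 amul1 amulrV //; exact: level_unit.
by rewrite -(ainvK (arat q)) -kq k1 ainv1.
Qed.

Variables (sigma : {rmorphism Qbar R -> Qbar R}) (tau : {rmorphism C -> C}).
Variable r : adele n.
Hypothesis tauE : forall x, tau (qbval x) = qbval (sigma x).
Hypothesis tau_reflexM : forall z, reflex M Y z -> tau z = z.
Hypothesis tau_fix : forall z, compositum (reflex M Y) (reflex G X) z -> tau z = z.
Hypothesis Kr : K r.
Hypothesis rP : forall K', neat_level cl G K' -> galois_point sigma (ptG K' s one) (ptG K' s r).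

Lemma galois_transport K' : neat_level cl G K' ->
  proportional (map_mx tau (ptG K' s one)) (ptG K' s r).
Proof.
move=> /rP[u [hu hu']]; apply: proportional_trans hu'.
apply/proportional_sym.
have -> : map_mx (fun x => qbval (sigma x)) u = map_mx tau (map_mx (@qbval R) u).
  by apply/matrixP => i j; rewrite !mxE tauE.
exact: proportional_map.
Qed.

Lemma transport_class K' K1 s1 m1 : neat_level cl M K' -> neat_level cl G K1 ->
  K' `<=` K1 -> Y s1 -> apts M m1 ->
  proportional (ptM K' s1 m1) (map_mx tau (ptM K' s one)) ->
  same_class G K1 s r s1 m1.
Proof.
move=> hK' hK1 K'K1 Ys1 Mm1 e.
have e1 := transport_image hG hs MG hMX tau_fix hK' hK1 K'K1 Ys1 Mm1 e.
apply/(cm_class Sh hG hK1 hs (level_apts Kr) (class_sub hG hs MG Ys1) (apts_sub MG Mm1)).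
exact: proportional_sym (proportional_trans e1 (galois_transport hK1)).
Qed.

Lemma representation_coset s0 m0 q0 k0 : Y s0 -> apts M m0 ->
  proportional (ptM KM s0 m0) (map_mx tau (ptM KM s one)) ->
  qpts G rat q0 -> K k0 -> s0 = conj_rat q0 s -> m0 = amul (arat q0) (amul r k0) ->
  apts M (amul (arat q0) r).
Proof.
move=> Ys0 Mm0 e0 Gq0 Kk0 s0E m0E.
have [uq0 ur uk0] := And3 (proj1 Gq0) (level_unit Kr) (level_unit Kk0).
have uaq0 := arat_unit uq0.
have Gg : apts G (amul (arat q0) r).
  have -> : amul (arat q0) r = amul m0 (ainv k0).
    by rewrite m0E amulA amulrK.
  by apply: apts_mul; [exact: apts_sub MG Mm0|exact/apts_inv/level_apts].
(* Closedness gives an [N] such that no [q0 r h] with [h] congruent to 1 modulo [N] is in [M(A_f)].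
   Conjugating at a level contained in that congruence subgroup will produce such a point. *)
apply: contrapT => nMg; have [N N0 hN] := apts_closed Gg nMg.
pose K1G := congr_level K N `&` apts G; pose K1M := congr_level K N `&` apts M.
have hK1G : neat_level cl G K1G by exact: neat_level_congr (@qsub_refl _ G) hK N0.
have hK1M : neat_level cl M K1M by exact: neat_level_congr MG hK N0.
have hKM : neat_level cl M KM by exact: neat_level_trace MG hK.
have K1MG : K1M `<=` K1G.
  by move=> g [Kg Mg]; split; [exact: Kg|exact: apts_sub MG Mg].
have K1MK : K1M `<=` KM by move=> g [[Kg _] Mg]; split.
have [s1 [m1 [Ys1 Mm1 e1]]] := transport_exists Sh hMX tau_reflexM hK1M.
have [q1 [k1 [Gq1 [[Kk1 Nk1] _] s1E m1E]]] := transport_class hK1M hK1G K1MG Ys1 Mm1 e1.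
have e2 := transport_level (Sh:=Sh) hMX tau_reflexM hK1M hKM K1MK Ys1 Mm1 e1.
have [c [k [Mc [Kk Mk] s0E' m0E']]] : same_class M KM s1 m1 s0 m0.
  apply/(cm_class Sh hMX hKM Ys1 Mm1 Ys0 Mm0).
  exact: proportional_trans e2 (proportional_sym e0).
have Gc := MG (pchar_num rat) Mc.
have [uq1 uc uk1 uk] := And4 (proj1 Gq1) (proj1 Gc) (level_unit Kk1) (level_unit Kk).
have [uaq1 uac] := (arat_unit uq1, arat_unit uc).
(* Seen at level [KM], the conjugate found at the deeper level is [s0, m0], up to [c] in [M(Q)].
   Thus [q0] and [c q1] both move [s] to [s0], and [d] measures their difference. *)
pose d := invmx q0 *m (c *m q1).
have Gd : qpts G rat d.
  have Q0 := pchar_num rat.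
  by apply: (qgroup_mul Q0); [exact: qgroup_inv Q0 Gq0|exact: qgroup_mul Q0 Gc Gq1].
have ds : conj_rat d s = s.
  have ucq : c *m q1 \in unitmx by rewrite unitmx_mul uc uq1.
  have uiq : invmx q0 \in unitmx by rewrite unitmx_inv uq0.
  rewrite /d -(conj_rat_mul s uiq ucq) -(conj_rat_mul s uc uq1).
  rewrite -[conj_rat q1 s]s1E -[conj_rat c s1]s0E' s0E.
  exact: conj_ratK.
have adE : arat d = amul (ainv (arat q0)) (amul (arat c) (arat q1)).
  by rewrite /d !arat_mul arat_inv.
have cq1 : amul (arat c) (arat q1) =
    amul (arat q0) (amul r (amul k0 (amul (ainv k) (amul (ainv k1) (ainv r))))).
  have e : amul (arat c) (amul (amul (arat q1) (amul r k1)) k) = amul (arat q0) (amul r k0).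
    by rewrite -m0E m0E' m1E.
  rewrite (amulA r k0) (amulA (arat q0)) -e !amulA.
  by rewrite (amulrK _ uk) (amulrK _ uk1) (amulrK _ ur).
have Kd : K (arat d).
  rewrite adE cq1 (amulK _ uaq0).
  apply: (level_mul Kr); apply: (level_mul Kk0); apply: level_mul; first exact: level_inv.
  by apply: level_mul; exact: level_inv.
have d1 := stabilizer_trivial Gd ds Kd.
have cq1' : amul (arat c) (arat q1) = arat q0.
  by rewrite -[RHS]amulr1 -d1 adE amulA (amulrV uaq0) amul1.
(* Since [c q1] and [q0] agree adelically, [q0 r k1 = c m1 = m0 k^-1], although [k1] is congruent to
   1 modulo [N]. *)
apply: (hN k1 Nk1).
have -> : amul (amul (arat q0) r) k1 = amul m0 (ainv k).
  by rewrite m0E' m1E -cq1' !amulA (amulrK _ uk).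
by apply: apts_mul; [exact: Mm0|exact: apts_inv].
Qed.

Lemma representation_exists : exists q, qpts G rat q /\ apts M (amul (arat q) r).
Proof.
have hKM : neat_level cl M KM by exact: neat_level_trace MG hK.
have KMK : KM `<=` K by move=> g [].
have [s1 [m1 [Ys1 Mm1 e1]]] := transport_exists Sh hMX tau_reflexM hKM.
have [q1 [k1 [Gq1 Kk1 s1E m1E]]] := transport_class hKM hK KMK Ys1 Mm1 e1.
by exists q1; split; [exact: Gq1|exact: representation_coset e1 Gq1 Kk1 s1E m1E].
Qed.

(** Now the conjugate can be taken to be [s, 1] itself. Then [q1] fixes [s] and is the inverse of
    [r k1], an element of [K], so it is trivial. *)
Lemma representation_fixed :
  proportional (ptM KM s one) (map_mx tau (ptM KM s one)) -> apts M r.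
Proof.
move=> e1; have hKM : neat_level cl M KM by exact: neat_level_trace MG hK.
have KMK : KM `<=` K by move=> g [].
have Ys := conj_class_self M s.
have [q1 [k1 [Gq1 Kk1 s1E m1E]]] := transport_class hKM hK KMK Ys (apts_one M) e1.
have := representation_coset Ys (apts_one M) e1 Gq1 Kk1 s1E m1E.
have uaq1 := arat_unit (proj1 Gq1).
have Krk := level_mul Kr Kk1.
have -> : arat q1 = one; last by rewrite amul1.
apply: (stabilizer_trivial Gq1 (esym s1E)).
have -> : arat q1 = ainv (amul r k1); last exact: level_inv.
by rewrite -[RHS]amul1 m1E (amulrK _ (level_unit Krk)).
Qed.
End Representation.

(** * Periodicity of the point on the Shimura variety of M *)

(** The index is shifted: [rpow f k] is the power of exponent [k.+1]. It is built from compositions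
    in the shape to which the multiplicativity in [galois_rep] applies. *)
Fixpoint rpow (A : pzRingType) (f : {rmorphism A -> A}) k : {rmorphism A -> A} :=
  if k is k'.+1 then GRing.RMorphism.clone _ _ (f \o rpow f k') _ else f.

Lemma rpowE (A : pzRingType) (f : {rmorphism A -> A}) k x : rpow f k x = iter k.+1 f x.
Proof. by elim: k => //= k ->. Qed.

Lemma iter_period (T : Type) (f : T -> T) k l x : iter k f x = x -> iter (l * k) f x = x.
Proof. by move=> fx; elim: l => //= l IH; rewrite mulSn iterD IH. Qed.

(** The iterates of [y] stay among the finitely many roots of [p], and injectivity of [f] turns a
    repetition into a return to [y]. *)
Lemma algebraic_period (C : fieldType) (F : set C) (f : {rmorphism C -> C}) y :
  (forall z, F z -> f z = z) -> algebraic_in F y ->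
  exists2 k, (0 < k)%N & iter k f y = y.
Proof.
move=> fF [p [p0 Fp py]].
have fp : map_poly f p = p by apply/polyP => k; rewrite coef_map /= fF.
have roots k : root p (iter k f y).
  by elim: k => //= k IH; rewrite -fp fmorph_root.
pose t := map (fun k => iter k f y) (iota 0 (size p)).
have : ~~ uniq t.
  apply/negP => ut; have := max_poly_roots p0 _ ut.
  rewrite size_map size_iota ltnn => h; suff : false by [].
  by apply: h; apply/allP => _ /mapP[k _ ->].
move=> /(uniqPn 0)[i [j [ij]]]; rewrite size_map size_iota => jp.
have ip := ltn_trans ij jp.
rewrite !(nth_map 0%N) ?size_iota // !nth_iota // !add0n => e.
exists (j - i)%N; first by rewrite subn_gt0.
have inj m : injective (iter m f) by elim: m => //= m IH a b /fmorph_inj /IH.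
by apply: (inj i); rewrite -iterD subnKC // ltnW.
Qed.

Lemma common_period (C : fieldType) (F : set C) (f : {rmorphism C -> C}) m (y : 'I_m -> C) :
  (forall z, F z -> f z = z) -> (forall a, algebraic_in F (y a)) ->
  exists k, forall a, rpow f k (y a) = y a.
Proof.
move=> fF yF.
have /choice[k kP] : forall a, exists k, (0 < k)%N /\ iter k f (y a) = y a.
  by move=> a; have [k k0 ky] := algebraic_period fF (yF a); exists k.
exists (\prod_a k a).-1 => a; rewrite rpowE prednK; last first.
  by rewrite prodn_gt0 // => b; case: (kP b).
by rewrite (bigD1 a) //= mulnC; apply: iter_period; case: (kP a).
Qed.

Lemma uncountable_complement (R : realType) (T : countType) (D : set R[i]) y (f : R[i] -> T) :
  subfield D -> ~ D y -> (forall a b, ~ D a -> ~ D b -> f a = f b -> a = b) -> False.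
Proof.
move=> hD nDy finj.
pose c (x : R) : R[i] := real_complex R x.
(* If a real number lies in [D], its translate by [y] does not. So [e] takes values outside [D], and
   it is injective once the case is recorded; this would make the unit interval countable. *)
pose e x := if `[< D (c x) >] then c x + y else c x.
have ne x : ~ D (e x).
  rewrite /e; case: asboolP => // Dx Dxy; apply: nDy.
  have [_ DB _] := hD.
  by have := DB _ _ Dxy Dx; rewrite addrC addKr.
have ctbl : countable `[0, 1 : R].
  apply/countable_injP; exists (fun x => pickle (`[< D (c x) >], f (e x))).
  move=> x x' _ _ /(pcan_inj pickleK)[dE /finj ee].
  have {}ee := ee (ne x) (ne x').
  have : c x = c x'.
    by move: ee; rewrite /e dE; case: asboolP => // _ /addIr.
  exact: (fmorph_inj (real_complex R)).
have := countable_lebesgue_measure0 ctbl; rewrite lebesgue_measure_itv /= lte_fin ltr01.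
by rewrite oppr0 adde0 => /eqP; rewrite eqe oner_eq0.
Qed.

Section Coordinates.
Variables (R : realType) (cl : forall p : prime_t, padic_closure R p)
  (Sh : canonical_models cl)
  (n : nat) (G : qgroup n) (X : set (dhom R n)) (K : set (adele n))
  (hG : shimura_datum G X) (hK : neat_level cl G K)
  (s : dhom R n) (hs : X s) (M : qgroup n) (MG : qsub M G)
  (hMX : shimura_datum M (conj_class M s)).
Local Notation C := R[i].
Local Notation Y := (conj_class M s).
Local Notation ptM := (cm_pt Sh M Y).
Local Notation ptG := (cm_pt Sh G X).
Local Notation one := (aone n).
Local Notation KM := (K `&` apts M).

Variables (L F : set C).
Hypothesis hF : subfield F.
Hypothesis LF : L `<=` F.
Hypothesis FM : reflex M Y `<=` F.
Hypothesis FMG : compositum (reflex M Y) (reflex G X) `<=` F.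
Hypothesis hx : @qp_rational R (cm_var Sh G X K) L (ptG K s one).

(** Such a [tau] fixes the rational point x, so the conjugate of [s, 1] stays in the fibre over x.
    This indexes the conjugates by rational matrices [q]. *)
Lemma fibre_class (tau : {rmorphism C -> C}) : (forall z, F z -> tau z = z) ->
  exists s1 m1 q k, [/\ Y s1, apts M m1, proportional (ptM KM s1 m1) (map_mx tau (ptM KM s one)),
    K k & s1 = conj_rat q s /\ m1 = amul (arat q) k].
Proof.
move=> tauF.
have hKM : neat_level cl M KM by exact: neat_level_trace MG hK.
have KMK : KM `<=` K by move=> g [].
have tM z : reflex M Y z -> tau z = z by move=> /FM /tauF.
have tMG z : compositum (reflex M Y) (reflex G X) z -> tau z = z by move=> /FMG /tauF.
have [s1 [m1 [Ys1 Mm1 e1]]] := transport_exists Sh hMX tM hKM.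
have e2 := transport_image hG hs MG hMX tMG hKM hK KMK Ys1 Mm1 e1.
have e3 : proportional (map_mx tau (ptG K s one)) (ptG K s one).
  have [w wL ew] := hx.
  have tw : map_mx tau w = w.
    by apply/rowP => j; rewrite mxE; exact/tauF/LF/wL.
  have := proportional_map tau ew; rewrite tw => ew'.
  exact: proportional_trans (proportional_sym ew') ew.
have [q [k [Gq Kk s1E m1E]]] : same_class G K s one s1 m1.
  apply/(cm_class Sh hG hK hs (apts_one G) (class_sub hG hs MG Ys1) (apts_sub MG Mm1)).
  exact: proportional_sym (proportional_trans e2 e3).
exists s1, m1, q, k; split; [exact: Ys1|exact: Mm1|exact: e1|exact: Kk|].
by split; [exact: s1E|rewrite m1E amul1].
Qed.

(** Were [y] transcendental, each [y'] outside [D] would be [tau y] for some [tau] fixing [F]; the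
    [q] attached to this [tau] would determine [y'], against uncountability. *)
Lemma coordinates_algebraic a b : ptM KM s one 0 b != 0 ->
  algebraic_in F (ptM KM s one 0 a / ptM KM s one 0 b).
Proof.
move=> vb; set y := _ / _; apply: contrapT => ny.
have hKM : neat_level cl M KM by exact: neat_level_trace MG hK.
have [D [hD FD nDy homs]] := transcendental_homs hF ny.
have /choice[f fP] : forall y', exists q : 'M[rat]_n, ~ D y' -> exists (tau : {rmorphism C -> C}) s1 m1 k,
    [/\ tau y = y', Y s1 /\ apts M m1, proportional (ptM KM s1 m1) (map_mx tau (ptM KM s one)),
    K k & s1 = conj_rat q s /\ m1 = amul (arat q) k].
  move=> y'; have [Dy'|nDy'] := pselect (D y'); first by exists 0.
  have [tau [tauD tauy]] := homs y' nDy'.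
  have [|s1 [m1 [q [k [Ys1 Mm1 e1 Kk [s1E m1E]]]]]] := @fibre_class tau.
    by move=> z /FD /tauD.
  by exists q => _; exists tau, s1, m1, k; split.
apply: (uncountable_complement hD nDy (f := f)) => y1 y2.
move=> /fP[t1 [s1 [m1 [k1 [ty1 [Ys1 Mm1] e1 Kk1 [s1E m1E]]]]]].
move=> /fP[t2 [s2 [m2 [k2 [ty2 [Ys2 Mm2] e2 Kk2 [s2E m2E]]]]]] q12.
have [uk1 um1] := (level_unit hK Kk1, apts_unit Mm1).
(* With the same [q], [s1 = s2] while [m1] and [m2] differ by an element of [K cap M]: the two
   conjugates are one point and have the same coordinate ratios. *)
have m2E' : m2 = amul m1 (amul (ainv k1) k2).
  by rewrite m2E -q12 m1E amulA (amulrK _ uk1).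
have e : proportional (ptM KM s1 m1) (ptM KM s2 m2).
  apply/(cm_class Sh hMX hKM Ys1 Mm1 Ys2 Mm2).
  exists 1%:M, (amul (ainv k1) k2); split.
  - by have [] := qgroupP M (pchar_num rat).
  - split; first by apply: (level_mul hK) => //; exact: (level_inv hK).
    rewrite -(amulK (amul (ainv k1) k2) um1) -m2E'.
    by apply: apts_mul; [exact: apts_inv|exact: Mm2].
  - by rewrite map_mx1 conj_dhom1 s2E -q12 -s1E.
  - by rewrite arat1 amul1.
have [c c0 ec] := proportional_trans (proportional_sym e1) (proportional_trans e e2).
have tE (t : {rmorphism C -> C}) : t y = map_mx t (ptM KM s one) 0 a / map_mx t (ptM KM s one) 0 b.
  by rewrite !mxE fmorph_div.
by rewrite -ty1 -ty2 !tE ec !mxE -mulf_div divff // mul1r.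
Qed.

Lemma point_period (tau : {rmorphism C -> C}) : (forall z, F z -> tau z = z) ->
  exists k, proportional (ptM KM s one) (map_mx (rpow tau k) (ptM KM s one)).
Proof.
move=> tauF.
have hKM : neat_level cl M KM by exact: neat_level_trace MG hK.
have [v0 _ _] := cm_mem Sh hMX hKM (conj_class_self M s) (apts_one M).
have [b vb] : exists b, ptM KM s one 0 b != 0.
  apply: contrapT => nb; move/eqP: v0; apply; apply/rowP => b; rewrite mxE.
  by apply: contrapT => /eqP vb; apply: nb; exists b.
have [k kP] := common_period tauF (fun a => coordinates_algebraic a vb).
exists k; exists (rpow tau k (ptM KM s one 0 b) / ptM KM s one 0 b).
  by rewrite mulf_neq0 ?invr_eq0 ?fmorph_eq0.
apply/rowP => a; rewrite !mxE; have := kP a; rewrite fmorph_div => e.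
rewrite mulrAC -mulrA -e mulrC divfK // fmorph_eq0.
exact: vb.
Qed.
End Coordinates.

(** * Extraction of prime roots by neatness *)

Section MatrixPowers.
Variables (F : fieldType) (n : nat).
Implicit Types g : 'M[F]_n.

Lemma mxpowD g a b : mxpow g (a + b) = mxpow g a *m mxpow g b.
Proof.
elim: b => [|b IH]; first by rewrite addn0 /= mulmx1.
by rewrite addnS /= IH mulmxA.
Qed.

Lemma mxpow1 g : mxpow g 1 = g.
Proof. by rewrite /= mul1mx. Qed.

Lemma mxpowS g k : mxpow g k.+1 = g *m mxpow g k.
Proof. by rewrite -add1n mxpowD mxpow1. Qed.

Lemma mxpowM g a b : mxpow g (a * b) = mxpow (mxpow g a) b.
Proof. by elim: b => [|b IH]; rewrite ?muln0 // mulnS addnC mxpowD IH. Qed.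

Lemma mxpow_map (E : fieldType) (f : {rmorphism F -> E}) g k :
  mxpow (map_mx f g) k = map_mx f (mxpow g k).
Proof. by elim: k => [|k IH]; rewrite ?map_mx1 //= IH map_mxM. Qed.

Lemma mxpow_qpts (M : qgroup n) g k : [pchar F] =i pred0 ->
  qpts M F g -> qpts M F (mxpow g k).
Proof.
move=> F0 Mg; elim: k => [|k IH]; first by have [] := qgroupP M F0.
by apply: qgroup_mul.
Qed.
End MatrixPowers.

Section Qbar.
Variable R : realType.

Definition qbar_val : {rmorphism Qbar R -> R[i]} :=
  GRing.RMorphism.clone _ _ (\val : Qbar R -> R[i]) _.

Lemma qbar_valP x : algebraicOver (@ratr R[i]) x <-> range qbar_val x.
Proof.
split=> [ax|[z _ <-]]; last exact/asboolP/(valP z).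
have ax' : x \in @algebraic_number R by exact/asboolP.
by exists (MkQbar ax').
Qed.

(** The root is a zero of [1 + X + ... + X^(l-1)], a polynomial whose value at 1 is [l]. *)
Lemma root_of_unity_exists l : prime l -> exists z : Qbar R, z ^+ l = 1 /\ z <> 1.
Proof.
move=> lp; have l1 := prime_gt1 lp.
have [z0] : exists x : R[i], root (\poly_(i < l) 1) x.
  apply/closed_rootP; rewrite size_poly_eq ?oner_neq0 //.
  by rewrite neq_ltn l1 orbT.
rewrite /root horner_poly => /eqP z0sum.
have z0l : z0 ^+ l = 1.
  apply/eqP; rewrite -subr_eq0 subrX1.
  by under eq_bigr do rewrite -[_ ^+ _]mul1r; rewrite z0sum mulr0.
have [z _ zE] : range qbar_val z0.
  apply/qbar_valP; exists ('X^l - 1); first exact/monic_neq0/monicXnsubC/prime_gt0.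
  by rewrite rmorphB /= map_polyXn rmorph1 /root !hornerE z0l subrr.
exists z; split; first by apply: (fmorph_inj qbar_val); rewrite rmorphXn rmorph1 zE.
move=> z1; move: z0sum; rewrite -zE z1 rmorph1.
under eq_bigr do rewrite expr1n mulr1.
rewrite sumr_const card_ord => /eqP; rewrite pnatr_eq0 => /eqP l0.
by move: l1; rewrite l0.
Qed.
End Qbar.

Section PrimeStep.
Variables (R : realType) (cl : forall p : prime_t, padic_closure R p) (n : nat).
Local Notation Gam g p := (@eigen_group R cl n g p).

Lemma eigen_group1 (g : adele n) p : Gam g p 1.
Proof. by move=> A _ A1 _. Qed.

Lemma eigen_groupV (g : adele n) p x y : Gam g p x -> Gam g p y -> Gam g p (x / y).
Proof. by move=> gx gy A hA A1 AV; exact: (AV _ _ (gx A hA A1 AV) (gy A hA A1 AV)). Qed.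

Lemma eigen_group_root (g : adele n) p x :
  root (char_poly (map_mx (pc_in (cl p)) (g p))) x -> Gam g p x.
Proof. by move=> rx A hA _ _; exact: hA. Qed.

Lemma eigen_group_neq0 (g : adele n) p x : g p \in unitmx -> Gam g p x -> x != 0.
Proof.
move=> ug gx; apply: (gx [set y | y != 0]) => [l||a b a0 b0] /=; last first.
- by rewrite mulf_eq0 invr_eq0 negb_or; apply/andP.
- by rewrite oner_neq0.
- rewrite -eigenvalue_root_char => /eigenvalueP[v vg v0]; apply: contraNneq v0 => l0.
  have ug' : map_mx (pc_in (cl p)) (g p) \in unitmx by rewrite map_unitmx.
  by rewrite -(mulmxK ug' v) vg l0 scale0r mul0mx.
Qed.

(** Neatness concerns one root of unity lying in all the groups Gamma_p, while the recurrences yield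
    one for each [p] separately. As [l] is prime, any nontrivial one generates all the [l]-th roots
    of unity. *)
Lemma torsion_all p l (g : adele n) (z : pc_field (cl p)) x : prime l ->
  Gam g p z -> z ^+ l = 1 -> z != 1 -> x ^+ l = 1 -> Gam g p x.
Proof.
move=> lp Gz zl z1 xl.
have [m prim ml] := prim_order_exists (prime_gt0 lp) zl.
have mE : m = l.
  have /primeP[_ /(_ m ml)/orP[/eqP m1|/eqP//]] := lp.
  by move/prim_expr_order: prim; rewrite m1 expr1 => z1'; rewrite z1' eqxx in z1.
rewrite mE in prim; have [i ->] := prim_rootP prim xl.
elim: (i : nat) => [|k IH]; first exact: eigen_group1.
have -> : z ^+ k.+1 = z ^+ k / (1 / z) by rewrite exprSr div1r invrK.
by apply: (eigen_groupV IH); apply: eigen_groupV Gz; exact: eigen_group1.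
Qed.

Variables (G M : qgroup n) (K : set (adele n)).
Hypotheses (hK : neat_level cl G K).

Lemma prime_power_in l q r : prime l -> K r -> q \in unitmx ->
  apts M (amul (arat q) r) -> (forall p, qpts M (Qp p) (mxpow (r p) l)) ->
  apts M r.
Proof.
move=> lp Kr uq Mqr Mrl; have Gr := level_apts hK Kr.
have ur := apts_unit Gr; have uaq := arat_unit uq.
apply: (apts_points Gr); apply: contrapT => nM.
have nMq : ~ qpts M rat q.
  move=> Mq; apply: nM => p.
  have Mqp : qpts M (Qp p) (arat q p) by apply/(qpts_rat _ _ (@pchar_Qp p)).
  rewrite -(mulKmx (uaq p) (r p)).
  by apply: (qgroup_mul (@pchar_Qp p)); [exact: qgroup_inv (@pchar_Qp p) Mqp|exact: (proj1 Mqr p)].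
have nMr p : ~ qpts M (Qp p) (r p).
  move=> Mr; apply: nMq; apply/(qpts_rat M q (@pchar_Qp p)).
  rewrite -[map_mx ratr q]/(arat q p) -(mulmxK (ur p) (arat q p)).
  by apply: (qgroup_mul (@pchar_Qp p)); [exact: (proj1 Mqr p)|exact: qgroup_inv (@pchar_Qp p) Mr].
have [z [zl z1]] := root_of_unity_exists R lp.
(* [z] is chosen in Qbar before [p]. At each [p], an equation [f] of [M] that fails at [r p] yields
   a nontrivial [w] in Gamma_p, whose powers include the image of [z]. *)
have [_ neat] := hK; apply: z1; apply: (neat r Kr z); first by exists l; rewrite ?prime_gt0.
move=> p.
have [f [Mf fr]] : exists f, qeqs M f /\ qeval f (r p) != 0.
  apply: contrapT => nf; apply: (nMr p); split=> [|f Mf]; first exact: ur.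
  by apply: contrapT => /eqP fr; apply: nf; exists f.
have urp : r p \in unitmx := ur p.
have [w [Gw wl w1]] : exists w, [/\ Gam r p w, w ^+ l = 1 & w != 1].
  apply: (@torsion_eigenvalue (pc_field (cl p)) (Gam r p) (@eigen_group1 r p)
    (fun x => @eigen_group_neq0 r p x urp) (@eigen_groupV r p) n
    (map_mx (pc_in (cl p)) (r p)) l ratr f lp).
  - by rewrite -(rmorph_nat (pc_in (cl p))) fmorph_eq0; exact: Qp_nat_neq0 (prime_gt0 lp).
  - by move=> x; exact: eigen_group_root.
  - move=> k; rewrite -/(qeval f _) mxpow_map qeval_map mxpowM.
    have [_ ->] := mxpow_qpts k (@pchar_Qp p) (Mrl p); first by rewrite rmorph0.
    exact: Mf.
  - rewrite -/(qeval f (map_mx (pc_in (cl p)) (r p))) qeval_map fmorph_eq0.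
    exact: fr.
by apply: (torsion_all lp Gw wl w1); rewrite -rmorphXn zl rmorph1.
Qed.
End PrimeStep.

(** * Descent over the compositum of L and the reflex field of M *)

Lemma subfield_compositum (R : realType) (E F : set R[i]) : subfield (compositum E F).
Proof.
split=> [A|x y hx hy A|x y hx hy A] hA EA FA.
- by case: hA.
- by case: (hA) => _ AB _; apply: AB; [exact: hx|exact: hy].
- by case: (hA) => _ _ AV; apply: AV; [exact: hx|exact: hy].
Qed.

Lemma compositum_l (R : realType) (E F : set R[i]) : E `<=` compositum E F.
Proof. by move=> x Ex A _ EA _; exact: EA. Qed.

Lemma compositum_r (R : realType) (E F : set R[i]) : F `<=` compositum E F.
Proof. by move=> x Fx A _ _ FA; exact: FA. Qed.

Lemma Gal_rpow (R : realType) (L : set R[i]) (sigma : {rmorphism Qbar R -> Qbar R}) k :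
  Gal L sigma -> Gal L (rpow sigma k).
Proof.
move=> Gs; elim: k => [|k [bk fk]] //.
have [bs fs] := Gs; split; first exact: bij_comp bs bk.
move=> x Lx; rewrite -[rpow _ _ x]/(sigma (rpow sigma k x)).
by rewrite fk // fs.
Qed.

Theorem proposition2p8 (R : realType) (cl : forall p : prime_t, padic_closure R p)
  (Sh : canonical_models cl)
  (n : nat) (G : qgroup n) (X : set (dhom R n)) (K : set (adele n))
  (hG : shimura_datum G X) (hK : neat_level cl G K)
  (L : set R[i]) (hL : number_field L) (hE : reflex G X `<=` L)
  (s : dhom R n) (hs : X s)
  (hx : @qp_rational R (cm_var Sh G X K) L (cm_pt Sh G X K s (aone n)))
  (hfib : simply_transitive G X K s)
  (rho : {rmorphism Qbar R -> Qbar R} -> adele n)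
  (hrho : galois_rep Sh G X K L s rho)
  (M : qgroup n) (hM : mumford_tate G s M)
  (hMX : shimura_datum M (conj_class M s)) :
  let L' := compositum L (reflex M (conj_class M s)) in
  (forall sigma, Gal L' sigma -> (apts M `&` K) (rho sigma)) /\
  (forall (l : prime_t) sigma, Gal L' sigma ->
     (qpts M (Qp l) `&` [set k l | k in K]) (rho sigma l)).
Proof.
move=> L'; have [MG _ _] := hM; have [rhoK rhoM rhoP] := hrho.
have hF : subfield L' := subfield_compositum _ _.
have LF : L `<=` L' := @compositum_l _ _ _.
have FM : reflex M (conj_class M s) `<=` L' := @compositum_r _ _ _.
(* The reflex field of [G] is in [L], so [L'] is large enough to define the morphisms from the
   varieties of [M] to those of [G]. *)
have FMG : compositum (reflex M (conj_class M s)) (reflex G X) `<=` L'.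
  by move=> z hz; apply: hz; [exact: hF|exact: FM|move=> x /hE /LF].
have GalL sigma : Gal L' sigma -> Gal L sigma.
  by move=> [bs fs]; split=> // x Lx; apply: fs; exact: LF.
have extend sigma : Gal L' sigma -> exists tau : {rmorphism R[i] -> R[i]},
    (forall z, L' z -> tau z = z) /\ forall b, tau (qbval b) = qbval (sigma b).
  move=> [_ fs]; apply: (extend_sigma (@qbar_valP R) hF (sigma := sigma)).
  exact: fs.
have coset sigma : Gal L' sigma ->
    exists q, qpts G rat q /\ apts M (amul (arat q) (rho sigma)).
  move=> Gs; have [tau [tauF tauE]] := extend sigma Gs.
  apply: (representation_exists hG hK hs MG hMX hfib tauE) => [z /FM/tauF//|z /FMG/tauF//||K' hK'].
    exact/rhoK/GalL.
  exact: rhoP (GalL _ Gs) hK'.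
suff main sigma : Gal L' sigma -> apts M (rho sigma).
  split=> [sigma Gs|l sigma Gs]; first by split; [exact: main|exact/rhoK/GalL].
  split; first exact: (proj1 (main sigma Gs) l).
  by exists (rho sigma); [exact/rhoK/GalL|].
move=> Gs; have Grs k := GalL _ (Gal_rpow k Gs).
have power k p : rho (rpow sigma k) p = mxpow (rho sigma p) k.+1.
  elim: k => [|k IH]; first by rewrite mxpow1.
  by rewrite mxpowS -IH /= rhoM; [|exact: GalL|exact: Grs].
have [k Mk] : exists k, apts M (rho (rpow sigma k)).
  have [tau [tauF tauE]] := extend sigma Gs.
  have [k kP] := point_period hG hK hs MG hMX hF LF FM FMG hx tauF.
  have tkF z : L' z -> rpow tau k z = z.
    by move=> Lz; rewrite rpowE; elim: k.+1 => //= m ->; exact: tauF.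
  have tkE b : rpow tau k (qbval b) = qbval (rpow sigma k b).
    by rewrite !rpowE; elim: k.+1 => //= m ->; exact: tauE.
  exists k; apply: (representation_fixed hG hK hs MG hMX hfib tkE _ _ _ _ kP).
  - by move=> z /FM/tkF.
  - by move=> z /FMG/tkF.
  - exact/rhoK/Grs.
  - by move=> K' hK'; exact: rhoP (Grs k) hK'.
(* The exponent is divided by its least prime factor [l]. For this the coset statement is applied to
   the power of [sigma] of exponent [j %/ l], which brings its own [q]. *)
have descent j : (0 < j)%N -> (forall p, qpts M (Qp p) (mxpow (rho sigma p) j)) ->
    forall p, qpts M (Qp p) (rho sigma p).
  have [m] := ubnP j; elim: m j => // m IH j; rewrite ltnS => jm j0 Mj.
  have [j1|j1] := leqP j 1.
    have e : j = 1%N by apply/eqP; rewrite eqn_leq j1 j0.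
    by move=> p; have := Mj p; rewrite e mxpow1; exact.
  pose l := pdiv j; have lp : prime l := pdiv_prime j1.
  have jE : (j %/ l * l)%N = j by rewrite divnK // pdiv_dvd.
  have j'0 : (0 < j %/ l)%N by rewrite divn_gt0 ?prime_gt0 // dvdn_leq // pdiv_dvd.
  have rE p : rho (rpow sigma (j %/ l).-1) p = mxpow (rho sigma p) (j %/ l).
    by rewrite power prednK.
  have [q [Gq Mq]] := coset _ (Gal_rpow (j %/ l).-1 Gs).
  apply: (IH (j %/ l)%N _ j'0).
    by apply: leq_trans jm; rewrite ltn_Pdiv // prime_gt1.
  move=> p; rewrite -rE; move: p.
  apply: (proj1 (prime_power_in hK lp _ (proj1 Gq) Mq _)).
    exact/rhoK/Grs.
  by move=> p; rewrite rE -mxpowM jE; exact: Mj.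
apply: (apts_points (level_apts hK (rhoK _ (GalL _ Gs)))).
by apply: (descent k.+1 (ltn0Sn k)) => p; rewrite -power; exact: (proj1 Mk p).
Qed.
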